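(* For every infinite cardinal $\mu$ such that $\mu^{<\mu}<\mu^+<2^\mu$, and for every well-behaved magma $(G,* )$ of size $\mu^{++}$, there is a coloring $c:G\rightarrow\mathbb N$ such that for every $X\subseteq G$ of size $\mu^+$ and every $i\in\mathbb N$, there are three distinct elements $x,y,z$ of $X$ such that $c(x*y*z)=i$ for both implementations of $x*y*z$, that is, $c((x*y)*z)=i$ and $c(x*(y*z))=i$.
   Context: A magma is a structure $(G,* )$ where $*$ is a binary operation on $G$ (not assumed associative or commutative). $[G]^{<\omega}$ denotes the collection of all finite subsets of $G$, and $\triangle$ denotes symmetric difference. A magma $(G,* )$ is well-behaved iff there exists a map $\varphi:G\rightarrow[G]^{<\omega}$ such that: (1) $\varphi$ is countable-to-one (every fiber $\varphi^{-1}\{a\}$ is countable); (2) for all $x\neq y$ in $G$, $\varphi(x)\triangle\varphi(y)\subseteq\varphi(x*y)\subseteq\varphi(x)\cup\varphi(y)$. *)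

(* Defs.v *)
From HB Require Import structures.
From mathcomp Require Import all_boot.
From mathcomp Require Import boolp classical_sets functions cardinality.

Set Implicit Arguments.
Unset Strict Implicit.
Unset Printing Implicit Defensive.

Local Open Scope classical_set_scope.
Local Open Scope card_scope.
Local Open Scope group_scope.

Reserved Notation "A '#<' B" (at level 79, format "A  '#<'  B").

Definition card_lt T U (A : set T) (B : set U) : bool :=
  (A #<= B) && ~~ (B #<= A).
Notation "A '#<' B" := (card_lt A B) : card_scope.

(* As there is no type of cardinals, a cardinal is represented by any type of
   that cardinality, and [B -> A] represents the cardinal power A^B.  Cardinal
   operations without a canonical representing type are given relationally. *)

(* N = M^+, the least cardinal above M *)
Definition is_succ_card (M N : Type) : Prop :=
  [set: M] #< [set: N] /\
  forall L : Type, [set: M] #< [set: L] -> [set: N] #<= [set: L].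

(* P = M^{<M}, the supremum of the cardinals M^K over all cardinals K < M *)
Definition is_weak_pow (M P : Type) : Prop :=
  (forall K : Type, [set: K] #< [set: M] -> [set: K -> M] #<= [set: P]) /\
  forall Q : Type,
    (forall K : Type, [set: K] #< [set: M] -> [set: K -> M] #<= [set: Q]) ->
    [set: P] #<= [set: Q].

Definition well_behaved (G : magmaType) : Prop :=
  exists phi : G -> set G,
    [/\ forall x, finite_set (phi x),
        forall a : set G, countable (phi @^-1` [set a]) &
        forall x y : G, x <> y ->
          phi x `+` phi y `<=` phi (x * y) /\
          phi (x * y) `<=` phi x `|` phi y].

(* Main.v *)
Require Import Defs.
From HB Require Import structures.
From mathcomp Require Import all_boot all_order finmap zify.
From mathcomp Require Import boolp classical_sets functions cardinality.
From mathcomp Require wochoice.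

Set Implicit Arguments.
Unset Strict Implicit.
Unset Printing Implicit Defensive.

Import Order.TTheory.
Local Open Scope order_scope.
Local Open Scope classical_set_scope.
Local Open Scope card_scope.

(** Let Mu, L and K be the initial ordinals of mu, its successor and the
    successor of that. If phi witnesses that G is well-behaved, then phi maps
    the product of three elements, in either bracketing, to a finite set that
    contains each point lying in exactly one of phi x, phi y, phi z and lies in
    the union of the three. It therefore suffices to colour the subsets of K
    so that, in any L-indexed family of finite sets with small fibres, some
    three members give a prescribed colour to all the sets in this range at
    once; this is [set_colouring].

    Reduction to points. A family can be thinned out to a Delta-system
    ([delta_system]): a finite root, and pairwise disjoint increasing m-tuples.
    Since K embeds into the functions from Mu to bool, there is a first
    difference [delta] on K. As mu^{<mu} = mu, there are only mu many patterns
    below a given level, so all the tuples may be assumed to be separated, and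
    to agree coordinate by coordinate, below one level. In the union of three
    tuples the pair with the largest [delta] then consists of the j-th
    coordinates of two of them, and the point closest to this pair is the j-th
    coordinate of the third, whatever part of the root is present. The index j
    is fixed beforehand by [prevalent_colour]. So a colour is to be read off
    three points of K, two of which are marked as the close pair, and the
    value n of [delta] on the close pair is a parameter that can be made
    large.

    Triples of points. Let rho be a subadditive function from pairs of K to L
    with small balls ([subadditive_function]), and let u be an increasing
    L-sequence in K. There are three cases, and the colouring recognizes them
    by the position of the third point. If some row of rho is unbounded along
    u ([case_row]), the third point is the least and has different distances
    to the close pair. If all rows are bounded but rho is unbounded on every
    large subsequence ([case_unbounded]), the third point is the greatest. In
    both cases rho supplies xi < d <= eta in L for a d of cofinality mu in a
    prescribed stationary set; the elements of index below n in an
    enumeration of the ordinals up to eta in type Mu include d for n large,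
    and are too few to be cofinal in d, so that for a suitable xi the first of
    them above xi is d itself. A colouring of L with stationary colour classes
    ([stationary_colouring]) then gives every colour. If rho is bounded by
    some s on a large subsequence ([chain_realized]), there need not be a way
    to recover ordinals of L above s from a triple. The third point is again
    the least, now with equal distances nu to the close pair, and the colour
    counts how often the parts of index below n of the two balls of radius nu
    around the close pair alternate; of an infinite count, which is an ordinal,
    the finite remainder is taken. Interleaving these sets in different ways gives
    an interval of consecutive counts that is as long as desired, and the
    2-adic valuation of the count then takes every value. *)

(** * Cardinals and initial ordinals *)

Lemma choice_in T U (u0 : U) (A : set T) (P : T -> U -> Prop) :
  (forall x, A x -> exists y, P x y) ->
  exists f : T -> U, forall x, A x -> P x (f x).
Proof.
move=> AP; have [x|f fP] := @choice _ _ (fun x y => A x -> P x y); last by exists f.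
have [/AP[y Pxy]|nA] := pselect (A x); first by exists y.
by exists u0.
Qed.

Lemma choice_ex T U (P : T -> U -> Prop) :
  (forall x, exists y, P x y) -> exists f : T -> U, forall x, P x (f x).
Proof. by move=> /choice[f fP]; exists f. Qed.

Definition embeds T U (A : set T) (B : set U) : Prop :=
  exists2 f : T -> U, forall x, A x -> B (f x) &
    forall x y, A x -> A y -> f x = f y -> x = y.

Lemma card_le_embeds T U (u0 : U) (A : set T) (B : set U) :
  (A #<= B) <-> embeds A B.
Proof.
split=> [/card_leP/injfunPex[f _ finj]|[f fAB finj]].
  pose g x := if pselect (A x) is left Ax
    then val (f (SigSub (mem_set Ax))) else u0.
  exists g => [x Ax|x y Ax Ay]; rewrite /g.
    case: pselect => // Ax' /=; exact: set_valP.
  case: pselect => // Ax'; case: pselect => // Ay' /val_inj /finj.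
  by rewrite !inE => /(_ I I) [].
apply/card_leP/injfunPex.
exists (fun x : A => SigSub (mem_set (fAB _ (set_valP x))) : B) => //.
by move=> x y _ _ [] /finj xy; apply: val_inj; apply: xy; exact: set_valP.
Qed.

Lemma embeds_trans T U V (A : set T) (B : set U) (C : set V) :
  embeds A B -> embeds B C -> embeds A C.
Proof.
move=> [f fAB fi] [g gBC gi]; exists (g \o f) => [x /fAB /gBC //|x y Ax Ay /=].
by move/gi => e; apply: fi => //; apply: e; exact: fAB.
Qed.

(** Comparability of cardinals: a maximal partial injection is either total
    or onto. *)
Lemma embeds_total T U (u0 : U) (t0 : T) : embeds [set: T] [set: U] \/ embeds [set: U] [set: T].
Proof.
pose P (R : set (T * U)) := forall p q, R p -> R q -> (p.1 = q.1) <-> (p.2 = q.2).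
have [F FP Ftot|R [PR maxR]] := @Zorn_bigcup (T * U)%type P.
  move=> p q [X FX Xp] [Y FY Yq].
  have [XY|YX] := Ftot _ _ FX FY.
    by apply: (FP _ FY) => //; exact: XY.
  by apply: (FP _ FX) => //; exact: YX.
have [dom|ndom] := pselect (forall x, exists y, R (x, y)).
  have [f Rf] := choice dom; left; exists f => // x y _ _ fxy.
  by apply/(PR _ _ (Rf x) (Rf y)).
have [rng|nrng] := pselect (forall y, exists x, R (x, y)).
  have [f Rf] := choice rng; right; exists f => // x y _ _ fxy.
  by apply/(PR _ _ (Rf x) (Rf y)).
move/existsNP: ndom => [x Rx]; move/existsNP: nrng => [y Ry]; exfalso.
apply: (maxR (R `|` [set (x, y)])).
  split; first by move=> p Rp; left.
  by move=> /(_ (x, y) (or_intror erefl)) Rxy; apply: Rx; exists y.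
move=> p q [Rp|->] [Rq|->] //=; first exact: PR.
- split=> pq; exfalso.
    by apply: Rx; exists p.2; rewrite -pq -surjective_pairing.
  by apply: Ry; exists p.1; rewrite -pq -surjective_pairing.
- split=> pq; exfalso.
    by apply: Rx; exists q.2; rewrite pq -surjective_pairing.
  by apply: Ry; exists q.1; rewrite pq -surjective_pairing.
Qed.

Lemma lt_ne d (O : porderType d) (x y : O) : x < y -> x <> y.
Proof. by move=> + E; rewrite E ltxx. Qed.

Definition wo d (O : orderType d) : Prop :=
  forall A : set O, A !=set0 -> exists2 m, A m & forall y, A y -> m <= y.

Lemma wo_ind d (O : orderType d) : wo O -> forall P : O -> Prop,
  (forall x, (forall y, y < x -> P y) -> P x) -> forall x, P x.
Proof.
move=> woO P IH x; apply: contrapT => nPx.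
have [|m /= nPm mP] := woO [set x | ~ P x]; first by exists x.
apply: nPm; apply: IH => y ym; apply: contrapT => /mP.
by rewrite leNgt ym.
Qed.

Lemma wo_rec d (O : orderType d) (V : Type) (v0 : V) (Phi : O -> (O -> V) -> V) :
  wo O -> exists g, forall x, g x = Phi x (fun y => if y < x then g y else v0).
Proof.
move=> woO.
have wfO : well_founded (fun x y : O => x < y).
  by apply: (wo_ind woO) => x IH; constructor.
pose F x (rec : forall y, y < x -> V) : V :=
  Phi x (fun y => if pselect (y < x) is left yx then rec y yx else v0).
exists (Fix wfO (fun=> V) F) => x.
rewrite Fix_eq => [|z f g fg].
  rewrite {1}/F; congr Phi; apply: funext => y.
  by case: pselect => [->|/negP/negbTE ->].
by rewrite /F; congr Phi; apply: funext => y; case: pselect.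
Qed.

Lemma fin_argmax dO (O : orderType dO) (g : nat -> O) k :
  exists2 j0, (j0 <= k)%N & forall j, (j <= k)%N -> g j <= g j0.
Proof.
elim: k => [|k [j0 j0k j0P]]; first by exists 0%N => // j; rewrite leqn0 => /eqP ->.
case: (leP (g k.+1) (g j0)) => [le1|lt1].
  exists j0 => [|j]; first exact: leqW.
  by rewrite leq_eqVlt => /predU1P[->//|/j0P].
exists k.+1 => // j; rewrite leq_eqVlt => /predU1P[->//|/j0P gj].
exact: le_trans gj (ltW lt1).
Qed.

(** Any 2^(i+1) consecutive numbers contain an odd multiple of 2^i. *)
Lemma logn2_hit i a : exists2 l, (l < 2 ^ i.+1)%N & logn 2 (a + l.+1) = i.
Proof.
pose q := ((a + 2 ^ i) %/ 2 ^ i.+1)%N.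
have E : (2 ^ i.+1 = 2 ^ i + 2 ^ i)%N by rewrite expnS mul2n addnn.
have p0 : (0 < 2 ^ i)%N by rewrite expn_gt0.
have h1 : (q * 2 ^ i.+1 <= a + 2 ^ i)%N := leq_divM _ _.
have h2 : (a + 2 ^ i < q.+1 * 2 ^ i.+1)%N by rewrite ltn_ceil // E addn_gt0 p0.
rewrite mulSn in h2; exists (q * 2 ^ i.+1 + 2 ^ i - a.+1)%N; first by lia.
have -> : (a + (q * 2 ^ i.+1 + 2 ^ i - a.+1).+1 = q * 2 ^ i.+1 + 2 ^ i)%N by lia.
rewrite expnS mulnA -[X in (_ + X)%N]mul1n -mulnDl lognM ?addn1 // pfactorK //.
by rewrite (@lognE 2) /= dvdn2 /= oddM andbF.
Qed.

(** Among the initial segments of a well-order of [T] that still embed [T],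
    the least one (or the whole order, if there is none) carries the wanted
    order, which is pulled back to [T]. *)
Lemma initial_order (T : Type) : exists (O : orderType (Order.Disp tt tt)),
  [/\ wo O, O = T :> Type &
     forall x : O, ~ embeds [set: O] [set y | y < x]].
Proof.
have [R Rwo] := wochoice.well_ordering_principle {classic T}.
have Rmin (A : set {classic T}) : A !=set0 -> exists2 m, A m & forall y, A y -> R m y.
  move=> [x Ax]; have [|m [[mA mP] _]] := Rwo (fun x => x \in A).
    by exists x; rewrite unfold_in; apply/mem_set.
  by exists m => [|y Ay]; [exact/set_mem|apply: mP; apply/mem_set].
have Rtot : total R.
  move=> x y; have [|m [->|->] mP] := Rmin [set x; y]; first by exists x; left.
    by rewrite mP //; right.
  by rewrite (mP x) ?orbT //; left.
have Rref : reflexive R by move=> x; have := Rtot x x; rewrite orbb.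
have Ranti : antisymmetric R.
  move=> x y /andP[xy yx].
  have [|m [_ mP]] := Rwo (fun z => z \in [set x; y]).
    by exists x; apply/mem_set; left.
  have hx : wochoice.minimum_of R (fun z => z \in [set x; y]) x.
    by split; [apply/mem_set; left|move=> z /set_mem[->|->]].
  have hy : wochoice.minimum_of R (fun z => z \in [set x; y]) y.
    by split; [apply/mem_set; right|move=> z /set_mem[->|->]].
  by rewrite -(mP _ hx) -(mP _ hy).
have Rtr : transitive R.
  move=> y x z xy yz.
  have [|m mA mP] := Rmin [set x; y; z]; first by exists x; left; left.
  case: mA => [[mx|my]|mz]; first by rewrite -mx; apply: mP; right.
    rewrite my in mP; have yx : R y x by apply: mP; left; left.
    by rewrite (Ranti x y) // xy yx.
  rewrite mz in mP; have zy : R z y by apply: mP; left; right.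
  by have -> : z = y by apply: Ranti; rewrite zy yz.
pose S := [set x | embeds [set: T] [set y | (y != x) && R y x]].
have [f fR finj] : exists2 f : {classic T} -> {classic T}, injective f &
    forall a, ~ embeds [set: T] [set y | (f y != f a) && R (f y) (f a)].
  have [/Rmin[x [f fx finj] xP]|/set0P/negP/negPn/eqP S0] := pselect (S !=set0).
    have {}finj : injective f by move=> y z; exact: finj.
    exists f => // a [g gA ginj].
    have := fx a I => /= /andP[fax Rfax].
    have /xP Rxfa : S (f a).
      exists (f \o g) => [y _|y z yT zT /= /finj]; first exact: (gA y I).
      exact: ginj.
    by move: fax; rewrite (Ranti (f a) x) ?eqxx // Rfax.
  exists id => // a [g gA ginj]; have : S a by exists g.
  by rewrite S0.
pose le x y := R (f x) (f y).
have le_ref : reflexive le by move=> x; exact: Rref.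
have le_anti : antisymmetric le by move=> x y /Ranti /fR.
have le_tr : transitive le by move=> y x z; exact: Rtr.
have le_tot : total le by move=> x y; exact: Rtot.
pose P := Order.Le_isPOrder.Build (Order.Disp tt tt) {classic T} le_ref le_anti le_tr.
pose O1 : porderType _ := HB.pack {classic T} P.
pose Q := Order.POrder_isTotal.Build (Order.Disp tt tt) O1 le_tot.
pose O : orderType _ := HB.pack {classic T} P Q.
exists O; split=> //.
  move=> A [x Ax]; have [|m [z Az <-] mP] := Rmin (f @` A).
    by exists (f x), x.
  exists z => // y Ay; apply: (mP (f y)); by exists y.
move=> a [g gA ginj]; apply: (finj a); exists g => // y _ /=.
have /= := gA y I; rewrite lt_def => /andP[ne le_ga].
apply/andP; split=> //; rewrite (inj_eq fR) eq_sym; exact: ne.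
Qed.

(** Cardinality at most |Mu|, and, by comparability, cardinality less than |Mu|. *)
Definition small d (Mu : orderType d) T (A : set T) : Prop := embeds A [set: Mu].
Definition tiny d (Mu : orderType d) T (A : set T) : Prop := ~ embeds [set: Mu] A.

(** * The cardinal mu and its successor *)

Section Core.
Context {dM dL : Order.disp_t} {Mu : orderType dM} {L : orderType dL}.
Hypothesis Mu_wo : wo Mu.
Hypothesis Mu_nat : embeds [set: nat] [set: Mu].
Hypothesis Mu_init : forall x : Mu, tiny Mu [set y | y < x].
Hypothesis Mu_pow : forall T : Type, tiny Mu [set: T] ->
  embeds [set: T -> Mu] [set: Mu].
Hypothesis L_wo : wo L.
Hypothesis L_seg : forall x : L, small Mu [set y | y < x].
Hypothesis L_large : ~ small Mu [set: L].

Notation small := (@small _ Mu _).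
Notation tiny := (@tiny _ Mu _).

Lemma embeds_sub T (A B : set T) : A `<=` B -> embeds A B.
Proof. by move=> AB; exists id. Qed.

Lemma small_sub T (A B : set T) : A `<=` B -> small B -> small A.
Proof. by move=> /embeds_sub; exact: embeds_trans. Qed.

Lemma tiny_sub T (A B : set T) : A `<=` B -> tiny B -> tiny A.
Proof. by move=> /embeds_sub AB tB /embeds_trans /(_ AB). Qed.

Lemma smallMu (A : set Mu) : small A.
Proof. by exists id. Qed.

Lemma tiny_image T U (f : T -> U) (A : set T) : tiny A -> tiny (f @` A).
Proof.
move=> tA [g gA gi]; apply: tA.
have [h hP] := choice_ex (fun m => let: ex_intro2 x Ax e := gA m I in
  ex_intro (fun x => A x /\ f x = g m) x (conj Ax e)).
exists h => [m _|m n _ _ mn]; first by case: (hP m).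
by apply: gi => //; have [_ <-] := hP m; have [_ <-] := hP n; rewrite mn.
Qed.

Lemma tiny_finite T (A : set T) : finite_set A -> tiny A.
Proof.
move=> fA [h hA hi]; have [g _ gi] := Mu_nat.
have [a _ _] : exists2 a, A a & True by exists (h (g 0%N)) => //; exact: hA.
have : finite_set [set: nat].
  apply: card_le_finite fA; apply/(card_le_embeds a); exists (h \o g) => [m _|m m' _ _ /=].
    exact: hA.
  by move/(hi _ _ I I)/(gi _ _ I I).
exact: infinite_nat.
Qed.

(** The pairs are the functions from bool to Mu. *)
Lemma Mu_square : embeds [set: Mu * Mu] [set: Mu].
Proof.
apply: embeds_trans (Mu_pow (tiny_finite (finite_finset (X := [set: bool])))).
exists (fun p b => if b then p.1 else p.2) => // -[a b] [a' b'] _ _ E.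
by congr pair; [have := congr1 (@^~ true) E|have := congr1 (@^~ false) E].
Qed.

Lemma small_bigcup J T (D : set J) (F : J -> set T) :
  small D -> (forall i, D i -> small (F i)) -> small (\bigcup_(i in D) F i).
Proof.
move=> [g _ gi] sF; have [e _ _] := Mu_nat; have [p _ pi] := Mu_square.
have [h hP] := @choice_in _ _ (fun=> e 0%N) D
    (fun i h => forall x y, F i x -> F i y -> h x = h y -> x = y) (fun i Di => let: ex_intro2 h _ hi := sF i Di in ex_intro _ h hi).
have [|k kP] := @choice_in _ _ (e 0%N) (\bigcup_(i in D) F i)
    (fun x m => exists i, [/\ D i, F i x & m = p (g i, h i x)]).
  by move=> x [i Di Fi]; exists (p (g i, h i x)), i.
exists k => // x y /kP[i [Di Fi ->]] /kP[j [Dj Fj ->]].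
move=> /(pi _ _ I I)[/(gi _ _ Di Dj) ij]; move: Fj; rewrite -ij => Fj.
exact: (hP i Di).
Qed.

Lemma small_setU T (A B : set T) : small A -> small B -> small (A `|` B).
Proof.
move=> sA sB; rewrite (_ : A `|` B = \bigcup_(n in [set: nat]) if n is 0%N then A else B).
  by apply: small_bigcup => // -[|n].
apply/seteqP; split=> [x [Ax|Bx]|x [[|n] _]]; by [exists 0%N|exists 1%N|left|right].
Qed.

Lemma small1 T (x : T) : small [set x].
Proof. by have [e _ _] := Mu_nat; exists (fun=> e 0%N) => // y z -> ->. Qed.

Lemma small_countable (T : countType) (A : set T) : small A.
Proof.
have [e _ ei] := Mu_nat; exists (e \o choice.pickle) => // x y _ _ /(ei _ _ I I).
exact: (pcan_inj choice.pickleK).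
Qed.

(** Of two disjoint copies of Mu in Mu, one omits a given maximum, and would
    embed into the segment below it. *)
Lemma Mu_nomax (m : Mu) : exists n, m < n.
Proof.
apply: contrapT => nm; have {}nm n : n <= m.
  by rewrite leNgt; apply/negP => mn; apply: nm; exists n.
have [e _ ei] := Mu_nat; have [p _ pi] := Mu_square.
have e01 : e 0%N <> e 1%N by move/(ei _ _ I I).
have half a : (forall x, p (a, x) <> m) -> False.
  move=> ap; apply: (@Mu_init m); exists (fun x => p (a, x)) => [x _ /=|x y _ _].
    by rewrite lt_neqAle nm andbT; apply/eqP.
  by move/(pi _ _ I I) => [].
apply: (half (e 0%N)) => x px; apply: (half (e 1%N)) => y py.
by move: (pi _ _ I I (etrans px (esym py))) => [/e01].
Qed.

(** Koenig: if D were cofinal, then a function on D whose value at d differs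
    from those of the first d functions would escape any enumeration in type
    Mu of the functions from D to Mu. *)
Lemma Mu_reg (D : set Mu) : tiny D -> exists n, forall d, D d -> d < n.
Proof.
move=> tD; apply: contrapT => nD.
have cof i : exists2 d, D d & i < d.
  have [n ni] := Mu_nomax i.
  apply: contrapT => nd; apply: nD; exists n => d Dd; apply: le_lt_trans ni.
  by rewrite leNgt; apply/negP => id; apply: nd; exists d.
have tD' : tiny [set: D].
  move=> [f _ fi]; apply: tD; exists (val \o f) => [x _|x y _ _ /=].
    exact: set_valP.
  by move/val_inj/(fi _ _ I I).
have [j _ ji] := Mu_pow tD'.
have [e _ _] := Mu_nat.
have [G GP] := @choice_in _ _ (fun=> e 0%N) (range j) (fun i h => j h = i)
  (fun i => fun '(ex_intro2 h _ E) => ex_intro _ h E).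
have [h hP] : exists h : D -> Mu, forall (d : D) i, i < val d -> h d <> G i d.
  apply: (choice_ex (P := fun (d : D) m => forall i, i < val d -> m <> G i d)) => d.
  apply: contrapT => n; apply: (@Mu_init (val d)).
  have {}n m : exists i, i < val d /\ m = G i d.
    apply: contrapT => nm; apply: n; exists m => i id mG; apply: nm.
    by exists i.
  have [k kP] := choice_ex n.
  exists k => [m _|m m' _ _ kk]; first by case: (kP m).
  by have [_ ->] := kP m; have [_ ->] := kP m'; rewrite kk.
have [d Dd jd] := cof (j h).
apply: (hP (SigSub (mem_set Dd)) (j h) jd).
by rewrite (ji (G (j h)) h I I (GP _ (ex_intro2 _ _ h I erefl))).
Qed.

Implicit Types (A Z : set L).

Definition eventually (P : L -> Prop) := exists b, forall c, b <= c -> P c.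
Definition unbounded A := forall b, exists2 a, A a & b <= a.

Lemma unbP A : ~ eventually (fun c => ~ A c) -> unbounded A.
Proof.
move=> nA b; apply: contrapT => nb; apply: nA; exists b => c bc Ac.
by apply: nb; exists c.
Qed.

(** Regularity of L, as completeness of the filter of final segments. *)
Lemma ev_all T (D : set T) (P : T -> L -> Prop) :
  small D -> (forall x, D x -> eventually (P x)) -> eventually (fun c => forall x, D x -> P x c).
Proof.
move=> sD DP.
have [c0 c0P] : exists c0 : L, forall x, D x -> exists2 b, b <= c0 & forall c, b <= c -> P x c.
  apply: contrapT => n; apply: L_large.
  have [L0|/contrapT[l0]] := pselect (~ inhabited L).
    have [e _ _] := Mu_nat; exists (fun=> e 0%N) => // x.
    by case: L0; constructor.
  have [b bP] := @choice_in _ _ l0 D (fun x b => forall c, b <= c -> P x c) DP.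
  apply: (@small_sub _ _ (\bigcup_(x in D) [set y | y < b x])).
    move=> c _; apply: contrapT => nc; apply: n; exists c => x Dx; exists (b x).
      by rewrite leNgt; apply/negP => cb; apply: nc; exists x.
    exact: bP.
  exact: small_bigcup.
exists c0 => c c0c x /c0P[b bc0]; apply; exact: le_trans c0c.
Qed.

Lemma L_inh : exists l : L, True.
Proof.
apply: contrapT => n; apply: L_large; have [h _ _] := Mu_nat.
by exists (fun=> h 0%N) => // x; case: n; exists x.
Qed.

Lemma ev_true (P : L -> Prop) : (forall c, P c) -> eventually P.
Proof. by have [l _] := L_inh => PT; exists l. Qed.

Lemma ev_imp (P Q : L -> Prop) : (forall c, P c -> Q c) -> eventually P -> eventually Q.
Proof. by move=> PQ [b bP]; exists b => c /bP /PQ. Qed.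

Lemma ev_pre (A : Prop) (P : L -> Prop) : (A -> eventually P) -> eventually (fun c => A -> P c).
Proof.
have [HA /(_ HA)[b bP]|nA _] := pselect A; first by exists b => c bc _; exact: bP.
exact: ev_true.
Qed.

Lemma ev_and (P Q : L -> Prop) : eventually P -> eventually Q -> eventually (fun c => P c /\ Q c).
Proof.
move=> [b bP] [b' bQ]; exists (Order.max b b') => c; rewrite ge_max => /andP[bc b'c].
by split; [exact: bP|exact: bQ].
Qed.

Lemma ev_ex (P : L -> Prop) : eventually P -> exists c, P c.
Proof. by move=> [b bP]; exists b; exact: bP. Qed.

Lemma ev_ge (b : L) : eventually (fun c => b <= c).
Proof. by exists b. Qed.

Lemma ev_gt (b : L) : eventually (fun c => b < c).
Proof.
apply: contrapT => n; apply: L_large.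
apply: (@small_sub _ _ ([set y | y < b] `|` [set b])); last exact: small_setU (L_seg b) (small1 b).
move=> c _; case: (ltgtP c b) => [||->]; [by left| |by right].
by move=> bc; case: n; exists c => e /(lt_le_trans bc).
Qed.

Lemma unb_gt A b : unbounded A -> exists2 a, A a & b < a.
Proof. by have [c bc] := ev_ex (ev_gt b) => /(_ c)[a Aa /(lt_le_trans bc)]; exists a. Qed.

Lemma unb_sub A Z : A `<=` Z -> unbounded A -> unbounded Z.
Proof. by move=> AZ uA b; have [a /AZ] := uA b; exists a. Qed.

Lemma unb_ev A (P : L -> Prop) : unbounded A -> eventually P -> unbounded (fun c => A c /\ P c).
Proof.
move=> uA [b bP] c; have [a Aa] := uA (Order.max b c).
by rewrite ge_max => /andP[ba ca]; exists a => //; split=> //; exact: bP.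
Qed.

Lemma pigeonhole_unb T (D : set T) Z (R : L -> T -> Prop) :
  small D -> unbounded Z -> (forall q, Z q -> exists2 t, D t & R q t) ->
  exists2 t, D t & unbounded (fun q => Z q /\ R q t).
Proof.
move=> sD uZ ZR; apply: contrapT => n.
have /(ev_all sD)[b bP] : forall t, D t -> eventually (fun c => ~ (Z c /\ R c t)).
  by move=> t Dt; apply: contrapT => /unbP u; apply: n; exists t.
by have [q Zq bq] := uZ b; have [t Dt Rqt] := ZR q Zq; apply: (bP q bq t Dt).
Qed.

Lemma unb_large A : unbounded A -> ~ small A.
Proof.
move=> uA sA; have [b bP] : eventually (fun c => forall a, A a -> a < c).
  by apply: ev_all => // a _; exact: ev_gt.
by have [a Aa ba] := uA b; have := bP a ba a Aa; rewrite ltxx.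
Qed.

(** A form of cofinality mu: Mu is regular, so suprema of increasing Mu-sequences
    have this property. *)
Definition cofmu (d : L) := forall D : set L, tiny D ->
  (forall x, D x -> x < d) -> exists2 b, b < d & forall x, D x -> x <= b.

Definition closed_under (f : L -> L) (d : L) := forall p, p < d -> f p < d.

Lemma small_le (x : L) : small [set y | y <= x].
Proof.
have [z xz] := ev_ex (ev_gt x).
by apply: small_sub (L_seg z) => y /= yx; exact: le_lt_trans xz.
Qed.

(** The supremum of a Mu-sequence in which each term dominates [f] on the
    segments up to the earlier ones. *)
Lemma exists_closed (f : L -> L) c : exists d, [/\ c < d, cofmu d & closed_under f d].
Proof.
have step (ih : Mu * (Mu -> L)) : exists v, c < v /\ forall j, j < ih.1 ->
    ih.2 j < v /\ forall p, p <= ih.2 j -> f p < v.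
  apply: ev_ex; apply: ev_and; first exact: ev_gt.
  apply: (ev_all (smallMu [set j | j < ih.1])) => j _.
  apply: ev_and; first exact: ev_gt.
  by apply: (ev_all (small_le _)) => p _; exact: ev_gt.
have [F FP] := choice_ex step.
have [g gE] := wo_rec c (fun i h => F (i, h)) Mu_wo.
have gc i : c < g i.
  by rewrite gE; have [] := FP (i, fun y => if y < i then g y else c).
have gj i j : j < i -> g j < g i /\ forall p, p <= g j -> f p < g i.
  move=> ji; rewrite [g i]gE.
  by have [_ /(_ j ji)/=] := FP (i, fun y => if y < i then g y else c); rewrite ji.
have [x xP] : exists x, forall i, [set: Mu] i -> g i < x.
  by apply: ev_ex; apply: ev_all => [|i _]; [exact: smallMu|exact: ev_gt].
have [|d /= dg dmin] := L_wo (A := [set x | forall i, g i < x]).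
  by exists x => i; exact: xP.
have dP p : p < d -> exists i, p <= g i.
  move=> pd; apply: contrapT => n.
  have /dmin : forall i, g i < p.
    by move=> i; rewrite ltNge; apply/negP => pg; apply: n; exists i.
  by rewrite leNgt pd.
have [e _ _] := Mu_nat.
exists d; split.
- by apply: lt_trans (gc (e 0%N)) (dg _).
- move=> D tD Dd.
  have [k kP] := @choice_in _ _ (e 0%N) D (fun x i => x <= g i) (fun x Dx => dP x (Dd x Dx)).
  have [n nP] := Mu_reg (tiny_image (f := k) tD).
  exists (g n) => // y Dy; apply: le_trans (kP y Dy) _.
  by have /gj[/ltW] : k y < n by apply: nP; exists y.
- move=> p /dP[i pi]; have [n ni] := Mu_nomax i.
  by have [_ /(_ p pi)/lt_trans] := gj _ _ ni; apply.
Qed.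

(** Ulam matrix: with [e d] an injection of the ordinals below [d] into Mu, for
    each [x] some value [m] is taken by [e d x] on a stationary set of [d]. One
    [m] serves for infinitely many [x], and the corresponding stationary sets
    are disjoint. *)
Lemma stationary_colouring : exists c : L -> nat, forall i f b,
  exists d, [/\ c d = i, b < d, cofmu d & closed_under f d].
Proof.
have [e eP] := choice_ex (fun d => let: ex_intro2 h _ hi := L_seg d in
  ex_intro (fun h : L -> Mu => forall x y, x < d -> y < d -> h x = h y -> x = y) h hi).
pose Stat x m := forall f, exists d, [/\ x < d, cofmu d, closed_under f d & e d x = m].
have ex_stat x : exists m, Stat x m.
  apply: contrapT => n.
  have {}n m : exists f, ~ exists d, [/\ x < d, cofmu d, closed_under f d & e d x = m].
    by apply/existsNP => S; apply: n; exists m.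
  have [f fP] := choice_ex n.
  have [|g gP] := @choice_ex _ _ (fun p v => forall m, [set: Mu] m -> f m p <= v).
    move=> p; apply: ev_ex; apply: ev_all => [|m _]; first exact: smallMu.
    exact: ev_ge.
  have [d [xd cd gd]] := exists_closed g x.
  apply: (fP (e d x)); exists d; split=> // p pd.
  by apply: le_lt_trans (gP p _ I) (gd p pd).
have [m mP] := choice_ex ex_stat.
have L_unb : unbounded [set: L] by move=> b; exists b.
have [m0 _ um] := pigeonhole_unb (R := fun q t => m q = t)
  (smallMu [set: Mu]) L_unb (fun q _ => ex_intro2 _ _ (m q) I erefl).
have [nx nxP] := choice_ex (fun b => let: ex_intro2 x Ax e :=
  unb_gt b um in
  ex_intro (fun x => m x = m0 /\ b < x) x (conj (proj2 Ax) e)).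
have [l0 _] := L_inh.
pose s i := iter i.+1 nx l0.
have sm i : m (s i) = m0 by case: (nxP (iter i nx l0)).
have s_lt i j : (i < j)%N -> s i < s j.
  elim: j => // j IH; rewrite ltnS leq_eqVlt => /predU1P[->|/IH /lt_trans].
    by case: (nxP (s j)).
  by apply; case: (nxP (s j)).
have s_inj i j : s i = s j -> i = j.
  by move=> E; case: (ltngtP i j) => // /s_lt; rewrite E ltxx.
have [c cP] := @choice_in _ _ 0%N [set d | exists i, s i < d /\ e d (s i) = m0]
  (fun d i => s i < d /\ e d (s i) = m0) (fun d H => H).
exists c => i f b.
have [d [sd cd fd ed]] := mP (s i) (fun p => Order.max (f p) b).
rewrite sm in ed.
have [scd ecd] : s (c d) < d /\ e d (s (c d)) = m0 by apply: cP; exists i.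
exists d; split=> //.
- by apply/s_inj/(eP d) => //; rewrite ecd ed.
- by have := fd _ sd; rewrite gt_max => /andP[].
- by move=> p /fd; rewrite gt_max => /andP[].
Qed.


Lemma tiny_embeds T U (A : set T) (B : set U) : embeds A B -> tiny B -> tiny A.
Proof. by move=> AB tB /embeds_trans /(_ AB). Qed.

Definition nx (m : Mu) : Mu := sval (cid (Mu_nomax m)).
Lemma lt_nx m : m < nx m. Proof. exact: (svalP (cid (Mu_nomax m))). Qed.

Lemma small_prod T U (A : set T) (B : set U) : small A -> small B ->
  small [set p | A p.1 /\ B p.2].
Proof.
move=> [f _ fi] [g _ gi]; have [h _ hi] := Mu_square.
exists (fun p => h (f p.1, g p.2)) => // -[a b] [a' b'] [/= Aa Bb] [Aa' Bb'].
by move=> /(hi _ _ Logic.I Logic.I)[/(fi _ _ Aa Aa')-> /(gi _ _ Bb Bb')->].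
Qed.

Lemma tiny_segment n : tiny [set: [set i : Mu | i < n]].
Proof.
move=> [h _ hi]; apply: (@Mu_init n).
exists (val \o h) => [x _|x y _ _ /= /val_inj/(hi _ _ Logic.I Logic.I)//].
exact: (set_valP (h x)).
Qed.

(** Mu is regular, so a tiny subset of Mu lies in a proper segment, and
    Mu^{<Mu} = Mu bounds the number of subsets of each segment. *)
Lemma small_tiny_subsets T (A : set T) : small A -> small [set e : set T | e `<=` A /\ tiny e].
Proof.
move=> [g _ gi].
apply: (@small_sub _ _ (\bigcup_(n in [set: Mu]) [set e | forall x, e x -> A x /\ g x < n])).
  move=> e [eA te]; have [n nP] := Mu_reg (tiny_image (f := g) te).
  by exists n => // x ex; split; [exact: eA|apply: nP; exists x].
apply: small_bigcup => [|n _]; first exact: smallMu.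
have [a _] : exists a : Mu, True by have [h _ _] := Mu_nat; exists (h 0%N).
apply: embeds_trans (Mu_pow (tiny_segment (n := n))).
exists (fun (e : set T) i => if `[< exists2 x, e x & g x = val i >] then a else nx a) => //.
have na : a <> nx a by move=> E; have := lt_nx a; rewrite -E ltxx.
have half (e e' : set T) : (forall x, e x -> A x /\ g x < n) ->
    (forall x, e' x -> A x /\ g x < n) ->
    (fun i : [set i : Mu | i < n] => if `[< exists2 x, e x & g x = val i >] then a else nx a) =
    (fun i => if `[< exists2 x, e' x & g x = val i >] then a else nx a) -> e `<=` e'.
  move=> eP eP' E x ex; have [Ax xn] := eP _ ex.
  have := congr1 (fun h => h (SigSub (mem_set xn : g x \in [set i | i < n]))) E => /=.
  case: asboolP => [_|[]]; last by exists x.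
  case: asboolP => [[y ey gxy] _|_ /na//].
  by rewrite -(gi y x) //; case: (eP' _ ey).
by move=> e e' eP eP' E; apply/seteqP; split; apply: half.
Qed.

(** * A subadditive function with small balls *)

Section Rho.
Context {dK : Order.disp_t} {K : orderType dK}.
Hypothesis K_wo : wo K.
Hypothesis K_seg : forall g : K, embeds [set a | a < g] [set: L].

(** [P g v] is the ball of radius [v] around [g] among the points below [g];
    the last clause is subadditivity. For the recursion at [g], let [en g]
    enumerate the points below [g] in type L. Its records form an increasing
    cofinal sequence of type at most L, and [P g v] is the union of the balls
    of radius [v] around those records which come before stage [v] and, up to
    there, pairwise lie in each other's balls of radius [v]. *)
Lemma coherent_system : exists P : K -> L -> set K,
  [/\ forall g v a, P g v a -> a < g,
      forall g v v', v <= v' -> P g v `<=` P g v',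
      forall g a, a < g -> exists v, P g v a,
      forall g v, small (P g v) &
      forall g v a, P g v a -> forall x, x < a -> (P a v x <-> P g v x)].
Proof.
have [en enP] := choice_ex (fun d => let: ex_intro2 h _ hi := K_seg d in
  ex_intro (fun h : K -> L => forall x y, x < d -> y < d -> h x = h y -> x = y) h hi).
pose rcd g b := b < g /\ forall b', b' < g -> en g b' < en g b -> b' < b.
pose good (h : K -> L -> set K) g v b := [/\ rcd g b, en g b <= v &
  forall b1 b2, rcd g b1 -> rcd g b2 -> b1 < b2 -> b2 <= b -> h b2 v b1].
have [P PE] := wo_rec (fun=> set0)
  (fun g (h : K -> L -> set K) v => [set a | exists2 b, good h g v b & a = b \/ h b v a]) K_wo.
have {}PE g v a : P g v a <-> exists2 b, good P g v b & a = b \/ P b v a.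
  rewrite {1}PE /=; split=> -[b [rb eb hb] ab].
    have [bg _] := rb; rewrite bg in ab; exists b => //; split=> // b1 b2 r1 r2 b12 b2b.
    by have := hb _ _ r1 r2 b12 b2b; case: r2 => ->.
  have [bg _] := rb; exists b; rewrite ?bg //; split=> // b1 b2 r1 r2 b12 b2b.
  by have := hb _ _ r1 r2 b12 b2b; case: r2 => ->.
have rcd_en g b1 b2 : rcd g b1 -> rcd g b2 -> b1 < b2 -> en g b1 < en g b2.
  move=> [b1g r1] [b2g r2] b12; rewrite ltNge le_eqVlt; apply/negP => /orP[/eqP e|].
    by move: b12; rewrite (enP g b1 b2) ?ltxx.
  by move=> /(r1 _ b2g); rewrite ltNge (ltW b12).
have good_le g v b b' : good P g v b -> rcd g b' -> b' <= b -> good P g v b'.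
  move=> [rb eb hb] rb' b'b; split=> //.
    move: b'b; rewrite le_eqVlt => /predU1P[->//|/(rcd_en _ _ _ rb' rb)/ltW].
    by move/le_trans; apply.
  by move=> b1 b2 r1 r2 b12 b2b'; apply: hb => //; exact: le_trans b'b.
have cofr g a : a < g -> exists2 b, rcd g b & a <= b.
  move=> ag; have [|l [b [bg ab] <-] bmin] := L_wo (A := en g @` [set b | b < g /\ a <= b]).
    by exists (en g a), a.
  exists b => //; split=> // b' b'g eb'; apply: lt_le_trans ab.
  rewrite ltNge; apply/negP => ab'.
  by move: eb'; rewrite ltNge bmin //; exists b'.
exists P.
have PH g : [/\ forall v a, P g v a -> a < g,
      forall v v', v <= v' -> P g v `<=` P g v',
      forall a, a < g -> exists v, P g v a,
      forall v, small (P g v) &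
      forall v a, P g v a -> forall x, x < a -> (P a v x <-> P g v x)]; last first.
  by split=> g; case: (PH g).
elim/(wo_ind K_wo): g => g IH.
have goodS v v' b : v <= v' -> good P g v b -> good P g v' b.
  move=> vv' [rb eb hb]; split=> //; first exact: le_trans vv'.
  move=> b1 b2 r1 r2 b12 b2b; have [b2g _] := r2.
  by have [_ /(_ _ _ vv') + _ _ _] := IH _ b2g; apply; exact: hb.
split.
- move=> v a /PE[b [[bg _] _ _] [->//|Pa]].
  by have [/(_ _ _ Pa) ab _ _ _ _] := IH _ bg; exact: lt_trans bg.
- move=> v v' vv' a /PE[b gb ab]; apply/PE; exists b; first exact: goodS gb.
  have [[bg _] _ _] := gb.
  by case: ab => [|Pa]; [left|right; have [_ /(_ _ _ vv') + _ _ _] := IH _ bg; apply].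
- move=> a /cofr[b rb ab].
  have [bg rb'] := rb.
  have evP b1 b2 : b2 <= b -> b1 < b2 -> eventually (fun v => P b2 v b1).
    move=> b2b b12; have [_ mono /(_ _ b12)[v Pv] _ _] := IH _ (le_lt_trans b2b bg).
    by exists v => v' vv'; exact: mono Pv.
  have sr : small [set b2 | rcd g b2 /\ b2 <= b].
    apply: embeds_trans (small_le (en g b)); exists (en g).
      move=> b2 [r2]; rewrite le_eqVlt => /predU1P[->|]; first exact: lexx.
      by move=> /(rcd_en _ _ _ r2 rb)/ltW.
    by move=> x y [[xg _] _] [[yg _] _]; exact: enP.
  have [v [[vb vP] va]] : exists v, (en g b <= v /\ forall b2, [set b2 | rcd g b2 /\ b2 <= b] b2 ->
      forall b1, [set b1 | (rcd g b1 /\ b1 <= b) /\ b1 < b2] b1 -> P b2 v b1) /\ (a = b \/ P b v a).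
    apply: ev_ex; apply: ev_and; first apply: ev_and; first exact: ev_ge.
      apply: ev_all => // b2 [r2 b2b]; apply: ev_all.
        by apply: small_sub sr => b1 [].
      by move=> b1 [_ b12]; exact: evP.
    move: ab; rewrite le_eqVlt => /predU1P[->|ab]; first by exists (en g b) => *; left.
    by apply: ev_imp (evP _ _ (lexx b) ab) => v; right.
  exists v; apply/PE; exists b => //; split=> // b1 b2 r1 r2 b12 b2b.
  by apply: vP => //; split=> //; split=> //; apply: le_trans b2b; exact: ltW.
- move=> v; apply: (@small_sub _ _ (\bigcup_(b in [set b | b < g /\ en g b <= v]) ([set b] `|` P b v))).
    by move=> a /PE[b [[bg _] eb _] ab]; exists b.
  apply: small_bigcup.
    apply: embeds_trans (small_le v); exists (en g) => [b []//|x y [xg _] [yg _]].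
    exact: enP.
  by move=> b [bg _]; apply: small_setU (small1 b) _; have [] := IH _ bg.
- move=> v a /PE[b gb ab] x xa; have [[bg _] _ hb] := gb.
  have [ltb _ _ _ cohb] := IH _ bg.
  have -> : P a v x <-> P b v x /\ x < a.
    by case: ab => [E|Pa]; [rewrite -E|rewrite (cohb _ _ Pa _ xa)]; split=> [|[]].
  have leab : a <= b by case: ab => [->//|/ltb/ltW].
  split=> [[Px _]|/PE[b' gb' xb']]; first by apply/PE; exists b => //; right.
  split=> //; have [[b'g _] _ hb'] := gb'.
  case: (ltgtP b' b) => [b'b|bb'|e].
  + have Pb' : P b v b' by apply: hb => //; [case: gb'|case: gb].
    case: xb' => [->//|Px]; have [/(_ _ _ Px) xlt _ _ _ _] := IH _ b'g.
    by rewrite -(cohb _ _ Pb' _ xlt).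
  + have Pb : P b' v b by apply: hb' => //; [case: gb|case: gb'].
    have xb := lt_le_trans xa leab.
    case: xb' => [xE|Px]; first by move: bb'; rewrite -xE ltNge (ltW xb).
    by have [_ _ _ _ coh'] := IH _ b'g; rewrite (coh' _ _ Pb _ xb).
  + rewrite e in xb'; case: xb' => // xE.
    by move: leab; rewrite -xE leNgt xa.
Qed.

Lemma subadditive_function : exists rho : K -> K -> L,
  [/\ forall g v, small [set a | a < g /\ rho a g <= v],
      forall a b g, a < b -> b < g -> rho a g <= Order.max (rho a b) (rho b g) &
      forall a b g, a < b -> b < g -> rho a b <= Order.max (rho a g) (rho b g)].
Proof.
have [P [P_lt P_mono P_all P_small P_coh]] := coherent_system.
have [[l0 _]|nL] := pselect (exists l : L, True); last first.
  by case: L_large; have [h _ _] := Mu_nat; exists (fun=> h 0%N) => // x; case: nL; exists x.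
have [r rP] := @choice_in _ _ l0 [set p : K * K | p.1 < p.2]
  (fun p v => P p.2 v p.1 /\ forall v', P p.2 v' p.1 -> v <= v')
  (fun p (H : p.1 < p.2) => let: ex_intro2 v h1 h2 := L_wo (A := [set v | P p.2 v p.1]) (P_all _ _ H) in
   ex_intro _ v (conj h1 h2)).
have {}rP a g v : a < g -> P g v a <-> r (a, g) <= v.
  move=> ag; have [Pr rmin] := rP (a, g) ag; split; first exact: rmin.
  by move/P_mono; apply.
exists (fun a g => r (a, g)); split.
- by move=> g v; apply: small_sub (P_small g v) => a [ag]; rewrite -rP.
- move=> a b g ab bg; rewrite -rP ?(lt_trans ab) //.
  set v := Order.max _ _; have Pb : P g v b by rewrite rP // /v le_max lexx orbT.
  by rewrite -(P_coh _ _ _ Pb _ ab) rP // /v le_max lexx.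
- move=> a b g ab bg; rewrite -rP //.
  set v := Order.max _ _; have Pb : P g v b by rewrite rP // /v le_max lexx orbT.
  by rewrite (P_coh _ _ _ Pb _ ab) rP ?(lt_trans ab) // /v le_max lexx.
Qed.

(** * The colouring of triples *)

(** [e h] enumerates the segment up to [h], [idx g v] the ball of radius [v] around
    [g], and [r] embeds K into the functions from Mu to bool. *)
Section Colour.
Variables (c : L -> nat) (e : L -> L -> Mu) (rho : K -> K -> L)
  (idx : K -> L -> K -> Mu) (r : K -> Mu -> bool).
Hypothesis cP : forall i f b,
  exists d, [/\ c d = i, b < d, cofmu d & closed_under f d].
Hypothesis e_inj : forall h s t, s <= h -> t <= h -> e h s = e h t -> s = t.
Hypothesis rho_small : forall g v, small [set a | a < g /\ rho a g <= v].
Hypothesis rho_le1 : forall x y z, x < y -> y < z ->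
  rho x z <= Order.max (rho x y) (rho y z).
Hypothesis rho_le2 : forall x y z, x < y -> y < z ->
  rho x y <= Order.max (rho x z) (rho y z).
Hypothesis idx_inj : forall g v x y, x < g -> rho x g <= v -> y < g -> rho y g <= v ->
  idx g v x = idx g v y -> x = y.
Hypothesis r_inj : injective r.

Definition agree n x y := forall i : Mu, i < n -> r x i = r y i.

Lemma exists_delta : exists delta : K -> K -> Mu, forall x y, x <> y ->
  agree (delta x y) x y /\ r x (delta x y) <> r y (delta x y).
Proof.
have [m _ _] := Mu_nat.
have [|dl dlP] := @choice_in _ _ (m 0%N) [set p : K * K | p.1 <> p.2]
   (fun p n => agree n p.1 p.2 /\ r p.1 n <> r p.2 n).
  move=> [x y] /= xy.
  have [|n /= rn nP] := Mu_wo (A := [set n | r x n <> r y n]).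
    by apply/existsNP => rxy; apply/xy/r_inj/funext.
  exists n; split=> // i i_n; apply: contrapT => /nP.
  by rewrite leNgt i_n.
by exists (fun x y => dl (x, y)) => x y /(dlP (x, y)).
Qed.

Definition delta : K -> K -> Mu := sval (cid exists_delta).

Lemma deltaP x y : x <> y -> agree (delta x y) x y /\ r x (delta x y) <> r y (delta x y).
Proof. exact: (svalP (cid exists_delta)). Qed.

Lemma agree_delta n x y : x <> y -> agree n x y <-> n <= delta x y.
Proof.
move=> /deltaP[ag nag]; split=> [agn|nd i i_n].
  by rewrite leNgt; apply/negP => /agn.
by apply: ag; exact: lt_le_trans nd.
Qed.

Lemma agree_sym n x y : agree n x y -> agree n y x.
Proof. by move=> ag i /ag. Qed.

Lemma agree_trans n x y z : agree n x y -> agree n y z -> agree n x z.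
Proof. by move=> axy ayz i i_n; rewrite axy ?ayz. Qed.

Lemma agree_le n m x y : n <= m -> agree m x y -> agree n x y.
Proof. by move=> nm ag i i_n; apply: ag; exact: lt_le_trans nm. Qed.

Lemma deltaC x y : x <> y -> delta x y = delta y x.
Proof.
move=> xy; have yx := nesym xy.
apply: le_anti; apply/andP; split; apply/agree_delta => //; apply: agree_sym;
exact/agree_delta.
Qed.

(** The windows exhaust the segment up to [h] by tiny sets, along an enumeration
    of it in type Mu. *)
Definition window (n : Mu) (h : L) : set L := [set t | t <= h /\ e h t < n].

Lemma tiny_window n h : tiny (window n h).
Proof.
apply: tiny_embeds (@Mu_init n); exists (e h) => [t []//|s t [sh _] [th _]].
exact: e_inj.
Qed.

(** The default [h] is returned when no element of the window is at least [s]. *)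
Definition min_window n h s : L :=
  if pselect (exists t, window n h t /\ s <= t /\ forall t', window n h t' -> s <= t' -> t <= t')
  is left ex then sval (cid ex) else h.

Lemma min_window_eq n h s d : window n h d -> s <= d ->
  (forall t, window n h t -> s <= t -> d <= t) -> min_window n h s = d.
Proof.
move=> Fd sd dmin; rewrite /min_window; case: pselect => [ex|[]]; last by exists d.
case: (cid ex) => t /= [Ft [st tmin]]; apply: le_anti.
by rewrite tmin //= dmin.
Qed.

(** Tiny sets that exhaust the ball of radius [v] around [g]. *)
Definition ball (v : L) (n : Mu) (g : K) : set K :=
  [set x | [/\ x < g, rho x g <= v & idx g v x < n]].

Lemma tiny_ball v n g : tiny (ball v n g).
Proof.
apply: tiny_embeds (@Mu_init n); exists (idx g v) => [t []//|x y [xg xv _] [yg yv _]].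
exact: idx_inj.
Qed.

(** The points of [B] at which the union of [A] and [B] passes from [A] to [B]. *)
Definition switch (A B : set K) : set K := [set b | B b /\
  exists2 a, A a & a < b /\ forall b', B b' -> a <= b' -> ~ b' < b].

(** The longest finite final segment of [S]: of an ordinal it keeps the
    remainder modulo omega. *)
Definition topfin (S : set K) : set K := [set x | S x /\ finite_set (S `&` [set y | x <= y])].

Lemma finite_topfin S : finite_set (topfin S).
Proof.
have [/K_wo[m [Sm fm] mmin]|/set0P/negP/negPn/eqP ->] := pselect (topfin S !=set0); last first.
  exact: finite_set0.
by apply: sub_finite_set fm => x tx; split; [case: tx|exact: mmin].
Qed.

Definition osc (A B : set K) : nat := #|` fset_set (topfin (switch A B))|%fset.

(** [x] and [y], with [x < y], are the close pair. *)
Definition triple_colour (x y z : K) : nat :=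
  let n := delta x y in
  if z < x then
    if rho z x == rho z y then logn 2 (osc (ball (rho z x) n x) (ball (rho z x) n y))
    else c (min_window n (rho z y) (rho z x))
  else c (min_window n (rho y z) (rho x z)).

(** An increasing family [u] of points, which are the selected coordinates of
    the members of a family of tuples. [D x y] is the largest [delta] over all
    coordinates of the members [x] and [y], [linked x y] says that it is reached
    at the selected coordinate, and [tau n x] codes the tuple of [x] below level
    [n]. *)
Section Family.
Variables (I : set L) (u : L -> K) (linked : L -> L -> Prop) (D : L -> L -> Mu)
  (tau : Mu -> L -> Mu).
Hypothesis uI : unbounded I.
Hypothesis u_lt : forall x y, I x -> I y -> x < y -> u x < u y.
Hypothesis linked_unb : forall X, X `<=` I -> unbounded X ->
  exists x y, [/\ X x, X y, x <> y & linked x y].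
Hypothesis DC : forall x y, D x y = D y x.
Hypothesis linkedD : forall x y, I x -> I y -> x <> y -> linked x y -> delta (u x) (u y) = D x y.
Hypothesis tauD : forall n x y, I x -> I y -> x <> y -> tau n x = tau n y -> n <= D x y.
Hypothesis tauDlt : forall n x x' z, I x -> I x' -> I z -> x <> z -> D x z < n ->
  tau n x' = tau n x -> D x' z < n.
Hypothesis tau_linked : forall n x x' y, I x -> I x' -> I y -> x <> y -> linked x y -> D x y < n ->
  tau n x' = tau n x -> linked x' y /\ D x' y = D x y.
Hypothesis tau_le : forall n m x y, n <= m -> tau m x = tau m y -> tau n x = tau n y.

Definition realized i := exists x y z, [/\ I x, I y & I z] /\
  [/\ x < y, x <> z & y <> z] /\
  [/\ linked x y, D x z < D x y, D y z < D x y & triple_colour (u x) (u y) (u z) = i].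

Definition tau_class (X : set L) n t : set L := [set q | X q /\ tau n q = t].

Lemma evN_unb (P : L -> Prop) : ~ eventually P -> unbounded (fun q => ~ P q).
Proof. by move=> nP; apply: unbP => eP; apply: nP; apply: ev_imp eP => q /contrapT. Qed.

(** There are only |Mu| many classes, so the bounded ones have a bounded union. *)
Lemma unb_tau_class X : eventually (fun q => X q -> forall n, unbounded (tau_class X n (tau n q))).
Proof.
have : eventually (fun q => forall n, [set: Mu] n -> forall t, [set: Mu] t -> tau_class X n t q -> unbounded (tau_class X n t)).
  apply: ev_all => [|n _]; first exact: smallMu.
  apply: ev_all => [|t _]; first exact: smallMu.
  apply: contrapT => /evN_unb nP; have [q /not_implyP[qc nu] _] := nP (sval (cid L_inh)).
  apply: nu; apply: unb_sub nP => p /not_implyP[]; by [].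
by apply: ev_imp => q + Xq n; apply.
Qed.

(** [q'] stands for its whole [tau]-class, from which the partner of [q] is
    chosen later, subject to further requirements. *)
Definition good X q := forall n0, exists q', [/\ X q', q' <> q, linked q' q,
  tau n0 q' = tau n0 q & forall n, unbounded (tau_class X n (tau n q'))].

(** Unboundedly many bad points would agree on a bad level and on the code there,
    and then no two of them could be linked. *)
Lemma ev_good X : X `<=` I -> eventually (fun q => X q -> good X q).
Proof.
move=> XI; have [b0 b0P] := unb_tau_class X.
apply: contrapT => /evN_unb /(@unb_ev _ (fun q => b0 <= q)) /(_ (ev_ge b0)) nP.
have [|n0 _ {}nP] := pigeonhole_unb (D := [set: Mu]) (R := fun q n0 => ~ exists q', [/\ X q', q' <> q, linked q' q,
    tau n0 q' = tau n0 q & forall n, unbounded (tau_class X n (tau n q'))]) (smallMu _) nP.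
  by move=> q [/not_implyP[_ /existsNP[n0 nq]] _]; exists n0.
have [|t _ {}nP] := pigeonhole_unb (D := [set: Mu]) (R := fun q t => tau n0 q = t) (smallMu _) nP.
  by move=> q _; exists (tau n0 q).
have [|x [y [/= [[[/not_implyP[Xx _] bx] _] xt] [[_ ny] yt] xy Rxy]]] := linked_unb _ nP.
  by move=> q [[[/not_implyP[/XI]]]].
by apply: ny; exists x; split=> //; [rewrite xt|exact: b0P].
Qed.

(** The element [d] enters the window because [delta x y] exceeds its index, and
    it is the first one after [rho z x] because the window has a gap below [d]. *)
Lemma col_low x y z d : x < y -> z < x -> rho z x < d -> d <= rho z y ->
  e (rho z y) d < delta x y ->
  (forall t, window (delta x y) (rho z y) t -> t < d -> t < rho z x) ->
  triple_colour x y z = c d.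
Proof.
move=> xy zx zxd dzy en gap; rewrite /triple_colour zx ifN; last first.
  by rewrite lt_eqF //; exact: lt_le_trans dzy.
congr c; apply: min_window_eq; [by split|exact: ltW|move=> t Ft st].
by rewrite leNgt; apply/negP => /(gap t Ft); rewrite ltNge st.
Qed.

Lemma col_high x y z d : x < y -> y < z -> rho x z < d -> d <= rho y z ->
  e (rho y z) d < delta x y ->
  (forall t, window (delta x y) (rho y z) t -> t < d -> t < rho x z) ->
  triple_colour x y z = c d.
Proof.
move=> xy yz xzd dyz en gap; rewrite /triple_colour ifN; last first.
  by rewrite -leNgt ltW //; exact: lt_trans yz.
congr c; apply: min_window_eq; [by split|exact: ltW|move=> t Ft st].
by rewrite leNgt; apply/negP => /(gap t Ft); rewrite ltNge st.
Qed.

(** Windows are tiny and [d] has cofinality mu. *)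
Lemma window_gap n h d : cofmu d -> exists2 b, b < d & forall t, window n h t -> t < d -> t <= b.
Proof.
move=> cof_d; have tW : tiny (window n h `&` [set t | t < d]).
  by apply: tiny_sub (@tiny_window n h) => t [].
have [t []//|b bd bP] := cof_d _ tW.
by exists b => // t Ft td; apply: bP.
Qed.

(** Otherwise [h] would embed an unbounded set into a segment. *)
Lemma inc_unb (h : L -> L) Z b : (forall x y, Z x -> Z y -> x < y -> h x < h y) ->
  unbounded Z -> exists2 q, Z q & b < h q.
Proof.
move=> hZ uZ; apply: contrapT => n; apply: (unb_large uZ).
apply: embeds_trans (small_le b); exists h => [q Zq /=|x y Zx Zy hxy].
  by rewrite leNgt; apply/negP => bq; apply: n; exists q.
by case: (ltgtP x y) => // xy; [have := hZ _ _ Zx Zy xy|have := hZ _ _ Zy Zx xy]; rewrite hxy ltxx.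
Qed.

(** The third point [p] is fixed first. There are |Mu| many [tau]-classes, so [d]
    can be chosen such that [rho (u p)] takes cofinally many values below [d] on
    every unbounded one. Once [q] with [rho (u p) (u q)] above [d] is fixed, its
    partner is found in such a class, with a value above the gap of the window. *)
Lemma case_row i : (exists2 p, I p & forall b, exists q, [/\ I q, p < q & b <= rho (u p) (u q)]) ->
  realized i.
Proof.
move=> [p Ip p_unb]; pose h q := rho (u p) (u q).
pose Q := [set q | [/\ I q, p < q & forall q', I q' -> p < q' -> q' < q -> h q' < h q]].
have QI : Q `<=` I by move=> q [].
have hQ x y : Q x -> Q y -> x < y -> h x < h y.
  by move=> [Ix px _] [_ _]; apply.
have uQ : unbounded Q.
  move=> b; have [v vP] : exists v, forall q, [set q | q <= b] q -> h q < v.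
    by apply: ev_ex; apply: ev_all => [|q _]; [exact: small_le|exact: ev_gt].
  have [|q [Iq pq vq] qmin] := L_wo (A := [set q | [/\ I q, p < q & v <= h q]]).
    exact: p_unb.
  exists q; last first.
    by rewrite leNgt; apply/negP => qb; move: vq; rewrite leNgt vP //; exact: ltW.
  split=> // q' Iq' pq' q'q; apply: lt_le_trans vq; rewrite ltNge; apply/negP => vq'.
  by move: q'q; rewrite ltNge qmin.
have [|f fP] := @choice_ex _ _ (fun b v => forall n, [set: Mu] n -> forall t, [set: Mu] t ->
    unbounded (tau_class Q n t) -> exists2 q, tau_class Q n t q & b < h q /\ h q < v).
  move=> b; apply: ev_ex.
  apply: ev_all => [|n _]; first exact: smallMu.
  apply: ev_all => [|t _]; first exact: smallMu.
  have [ucl|nu] := pselect (unbounded (tau_class Q n t)); last exact: ev_true.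
  have [x y [Qx _] [Qy _]|q clq bq] := inc_unb (h := h) b _ ucl; first exact: hQ.
  by apply: ev_imp (ev_gt (h q)) => v hv _; exists q.
have [d [cd _ cof_d fd]] := cP i f p.
have [q [[Qq gq] dq]] : exists q, (Q q /\ good Q q) /\ d < h q.
  have [||q [Qq gq] dq] := @inc_unb h (fun q => Q q /\ good Q q) d; last by exists q.
    by move=> x y [Qx _] [Qy _]; exact: hQ.
  by apply: unb_sub (unb_ev uQ (ev_good QI)) => q [Qq /(_ Qq)].
have [Iq pq _] := Qq.
pose n0 := nx (Order.max (e (h q) d) (D q p)).
have := lt_nx (Order.max (e (h q) d) (D q p)); rewrite -/n0 gt_max => /andP[en0 Dn0].
have [s [Qs sq Rsq ts us]] := gq n0.
have n0D : n0 <= D s q by apply: tauD => //; exact: QI.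
have [b bd bP] := window_gap (D s q) (h q) cof_d.
have [q' [Qq' tq'] [bq' q'f]] := fP b (nx (D s q)) Logic.I _ Logic.I (us _).
have q'd : h q' < d by apply: lt_trans (fd _ bd).
have [Iq' pq' _] := Qq'.
have [Rq'q Dq'q] : linked q' q /\ D q' q = D s q.
  by apply: (tau_linked _ _ _ sq Rsq (lt_nx _) tq') => //; exact: QI.
have q'q : q' < q.
  case: (ltgtP q' q) => // [/(hQ _ _ Qq Qq')|E].
    by rewrite ltNge (ltW (lt_trans q'd dq)).
  by move: q'd; rewrite E ltNge (ltW dq).
have tq'q : tau n0 q' = tau n0 q.
  by rewrite -ts; apply: tau_le tq'; apply: le_trans n0D (ltW (lt_nx _)).
have qp : q <> p by apply/nesym/lt_ne.
exists q', q, p; split=> //; split; first by split=> //; exact/nesym/lt_ne.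
rewrite Dq'q; split=> //.
- by apply: lt_le_trans n0D; apply: tauDlt tq'q.
- exact: lt_le_trans n0D.
rewrite -cd; have dl : delta (u q') (u q) = D s q by rewrite linkedD //; exact: lt_ne.
apply: col_low; rewrite ?dl //; first exact: u_lt.
- exact: u_lt.
- exact: ltW.
- exact: lt_le_trans n0D.
- by move=> t Ft td; apply: le_lt_trans bq'; exact: bP.
Qed.

Definition chain X s := forall p q, X p -> X q -> p < q -> rho (u p) (u q) < s.

(** If [Z] did not escape, then any two of its points would lie in a common ball
    of radius [s] around a later point, hence at distance less than [s]. *)
Lemma escape Z s : Z `<=` I -> unbounded Z -> ~ chain Z s -> eventually (fun b => forall q, I q -> b <= q ->
  exists p, [/\ Z p, p < b & s <= rho (u p) (u q)]).
Proof.
move=> ZI uZ nchain; apply: contrapT => /evN_unb nP; apply: nchain => p p' Zp Zp' pp'.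
have [b /existsNP[q /not_implyP[Iq /not_implyP[bq nq]]] p'b] := unb_gt p' nP.
have lt_s x : Z x -> x < b -> rho (u x) (u q) < s.
  by move=> Zx xb; rewrite ltNge; apply/negP => sx; apply: nq; exists x.
apply: le_lt_trans (rho_le2 (u_lt (ZI _ Zp) (ZI _ Zp') pp') (u_lt (ZI _ Zp') Iq (lt_le_trans p'b bq))) _.
by rewrite gt_max !lt_s //; exact: lt_trans p'b.
Qed.

(** The points [y < z] beyond [d] with [rho (u y) (u z)] at least [d] are fixed
    first. The partner of [y] is sought in an unbounded [tau]-class: by [escape],
    [rho] takes values cofinal in [d] between this class and [z], and they stay
    below [d] because the rows are bounded. *)
Lemma case_unbounded i :
  ~ (exists2 p, I p & forall b, exists q, [/\ I q, p < q & b <= rho (u p) (u q)]) ->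
  ~ (exists X s, [/\ X `<=` I, unbounded X & chain X s]) -> realized i.
Proof.
move=> nrow nchain.
have [l0 _] := L_inh.
have [p Ip|g gP] := @choice_in _ _ l0 I (fun p v => forall q, I q -> p < q -> rho (u p) (u q) < v).
  apply: contrapT => n; apply: nrow; exists p => // b.
  apply: contrapT => nq; apply: n; exists b => q Iq pq.
  by rewrite ltNge; apply/negP => bq; apply: nq; exists q.
have esc n t s : unbounded (tau_class I n t) -> eventually (fun b => forall q, I q -> b <= q ->
    exists p, [/\ tau_class I n t p, p < b & s <= rho (u p) (u q)]).
  move=> ucl; have clI : tau_class I n t `<=` I by move=> p [].
  by apply: escape => // chs; apply: nchain; exists (tau_class I n t), s.
have [|f fP] := @choice_ex _ _ (fun b v =>
    (b < v /\ forall p, [set p | p <= b] p -> g p <= v) /\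
    forall n, [set: Mu] n -> forall t, [set: Mu] t -> unbounded (tau_class I n t) ->
    forall q, I q -> v <= q -> exists p, [/\ tau_class I n t p, p < v & b <= rho (u p) (u q)]).
  move=> b; apply: ev_ex; apply: ev_and.
    apply: ev_and; first exact: ev_gt.
    by apply: ev_all => [|p _]; [exact: small_le|exact: ev_ge].
  apply: ev_all => [|n _]; first exact: smallMu.
  apply: ev_all => [|t _]; first exact: smallMu.
  have [ucl|nu] := pselect (unbounded (tau_class I n t)); last exact: ev_true.
  by apply: ev_imp (esc n t b ucl).
have [d [cd _ cof_d fd]] := cP i f l0.
pose X := [set q | I q /\ (d <= q /\ good I q)].
have uX : unbounded X.
  apply: unb_sub (unb_ev uI (ev_and (ev_ge d) (ev_good (@subset_refl _ I)))).
  by move=> q [Iq [dq /(_ Iq)]].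
have [y [z [[Iy [dy gy]] [Iz [dz _]] yz dyz]]] : exists y z, [/\ X y, X z, y < z & d <= rho (u y) (u z)].
  apply: contrapT => n; apply: nchain; exists X, d; split=> // [q []//|y z Xy Xz yz].
  by rewrite ltNge; apply/negP => dyz; apply: n; exists y, z.
pose n0 := nx (Order.max (e (rho (u y) (u z)) d) (D y z)).
have := lt_nx (Order.max (e (rho (u y) (u z)) d) (D y z)); rewrite -/n0 gt_max => /andP[en0 Dn0].
have [s [Is sy Rsy ts us]] := gy n0.
have n0D : n0 <= D s y by apply: tauD.
have [b bd bP] := window_gap (D s y) (rho (u y) (u z)) cof_d.
have fbd := fd _ bd; have [[bfb _] _] := fP b.
have [_ /(_ (nx (D s y)) Logic.I _ Logic.I (us _) z Iz)] := fP (f b).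
have ffbd := fd _ fbd; case; first by apply: le_trans dz; exact: ltW.
move=> p [[Ip tp] pff fbp].
have pd := lt_trans pff ffbd; have py := lt_le_trans pd dy.
have [Rpy Dpy] : linked p y /\ D p y = D s y by apply: (tau_linked _ _ _ sy Rsy (lt_nx _) tp).
have tpy : tau n0 p = tau n0 y.
  by rewrite -ts; apply: tau_le tp; apply: le_trans n0D (ltW (lt_nx _)).
have pzd : rho (u p) (u z) < d.
  apply: lt_le_trans (gP _ Ip _ Iz (lt_trans py yz)) _.
  have [[_ /(_ p (lexx p)) gpf] _] := fP p.
  by apply: le_trans gpf (ltW (fd _ pd)).
exists p, y, z; split=> //; split.
  by split=> //; apply: lt_ne => //; exact: lt_trans yz.
rewrite Dpy; split=> //.
- by apply: lt_le_trans n0D; apply: tauDlt tpy => //; exact: lt_ne.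
- exact: lt_le_trans n0D.
rewrite -cd; have dl : delta (u p) (u y) = D s y by rewrite linkedD //; exact: lt_ne.
apply: col_high; rewrite ?dl //; [exact: u_lt|exact: u_lt|exact: lt_le_trans n0D|].
by move=> t Ft td; apply: le_lt_trans (lt_le_trans bfb fbp); exact: bP.
Qed.

(** * Bounded families: oscillation *)

(** Since [sq] is finite and on top, it only adds to the finite final segment. *)
Lemma osc_split (A B S : set K) sq b :
  switch A B = S `|` [set` sq] -> uniq sq -> (forall x, S x -> x < b) ->
  (forall x, x \in sq -> b <= x) ->
  osc A B = (#|` fset_set (topfin S)|%fset + size sq)%N.
Proof.
move=> E usq Sb sqb; rewrite /osc E.
have -> : topfin (S `|` [set` sq]) = topfin S `|` [set` sq].
  apply/seteqP; split=> x.
    move=> [[Sx|xsq] fx]; [left|by right]; split=> //.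
    by apply: sub_finite_set fx => y [Sy xy]; split=> //; left.
  move=> [[Sx fx]|xsq]; split; [by left| |by right|].
    apply: (@sub_finite_set _ _ ((S `&` [set y | x <= y]) `|` [set` sq])).
      by move=> y [[Sy|ysq] xy]; [left|right].
    by rewrite finite_setU; split=> //; exact: finite_seq.
  apply: (@sub_finite_set _ _ [set` sq]); last exact: finite_seq.
  move=> y [[Sy|//] xy]; have := Sb _ Sy; rewrite ltNge.
  by rewrite (le_trans (sqb _ xsq) xy).
have fsq : finite_set [set` sq] by exact: finite_seq.
rewrite fset_setU ?cardfsU //; last exact: finite_topfin.
rewrite (_ : (fset_set (topfin S) `&` fset_set [set` sq])%fset = fset0); last first.
  apply/fsetP => x; rewrite !inE in_fset_set ?in_fset_set //; last exact: finite_topfin.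
  apply/negbTE/negP => /andP[/set_mem[Sx _] /set_mem/= xsq].
  by have := Sb _ Sx; rewrite ltNge sqb.
rewrite cardfs0 subn0; congr addn.
have -> : fset_set [set` sq] = [fset x in sq]%fset.
  by apply/fsetP => x; rewrite in_fset_set // !inE; apply/idP/idP => [/set_mem|/mem_set].
by rewrite card_fseq undup_id.
Qed.

(** The bounded case: [s] is the least strict bound for [rho] on pairs that any
    unbounded subfamily admits, and [X] is a subfamily that admits it. *)
Section Chain.
Variables (X : set L) (s : L).
Hypothesis XI : X `<=` I.
Hypothesis uX : unbounded X.
Hypothesis chX : chain X s.
Hypothesis s_min : forall s' Y, s' < s -> Y `<=` I -> unbounded Y -> ~ chain Y s'.

(** By subadditivity the balls of radius less than [s] around the points of [X]
    are initial segments of this set. *)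
Definition branch : set K := [set x | exists2 q, X q & x < u q /\ rho x (u q) < s].

Lemma small_branch p : X p -> small (branch `&` [set x | x < u p]).
Proof.
move=> Xp; apply: small_sub (rho_small (u p) s) => x [[q Xq [xq rxq]] xp]; split=> //.
apply: ltW; case: (ltgtP p q) => [pq|qp|E]; last by rewrite E.
- have upq := u_lt (XI Xp) (XI Xq) pq.
  by apply: le_lt_trans (rho_le2 xp upq) _; rewrite gt_max rxq; exact: chX.
- have uqp := u_lt (XI Xq) (XI Xp) qp.
  by apply: le_lt_trans (rho_le1 xq uqp) _; rewrite gt_max rxq; exact: chX.
Qed.

Definition fan w v n t : set L :=
  [set q | [/\ X q, w < q, rho (u w) (u q) = v & tau (nx n) q = t]].

(** The position in a game of [m] more moves, in each of which a new block is to
    be added to [a] above an arbitrary bound, so that in the end the blocks form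
    exactly the set [ball v n (u q)] for some [q] of the prescribed type. *)
Fixpoint rich w v n t (m : nat) (a : set K) : Prop :=
  if m is m'.+1 then forall b, X b -> exists2 p, X p & exists a',
    [/\ a' !=set0, forall x, a' x -> u b <= x /\ x < u p & rich w v n t m' (a `|` a')]
  else exists2 q, fan w v n t q & ball v n (u q) = a.

Lemma ball_branch v n q : v < s -> X q -> ball v n (u q) `<=` branch.
Proof. by move=> vs Xq x [xq xv _]; exists q => //; split=> //; exact: le_lt_trans vs. Qed.

Lemma rich_sub w v n t m a : rich w v n t m a -> exists2 q, X q & a `<=` ball v n (u q).
Proof.
elim: m a => [|m IH] a /=; first by move=> [q [Xq _ _ _] <-]; exists q.
have [b Xb _] := uX s => /(_ b Xb)[p Xp [a' [_ _ /IH[q Xq aq]]]].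
by exists q => // x ax; apply: aq; left.
Qed.

(** This replaces an elementary submodel: if all [b] below [d] have such a [c']
    below [d], then [d] reflects every statement about richness. *)
Definition witnessed eps b c' :=
  (exists2 p, X p & b < p /\ p < c') /\
  (X b -> forall w, [set w | w < eps] w -> forall v, [set v | v < s] v ->
    forall n, [set: Mu] n -> forall t, [set: Mu] t -> forall m, [set: nat] m ->
    forall a, [set a | a `<=` branch `&` [set x | x < u b] /\ tiny a] a ->
    (rich w v n t 0 a -> exists q, [/\ fan w v n t q, q < c' & ball v n (u q) = a]) /\
    ((rich w v n t m.+1 a -> exists p, [/\ X p, p < c' & exists a',
          [/\ a' !=set0, forall x, a' x -> u b <= x /\ x < u p & rich w v n t m (a `|` a')]]) /\
     (~ rich w v n t m.+1 a -> exists b', [/\ X b', b' < c' & ~ exists2 p, X p & exists a',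
          [/\ a' !=set0, forall x, a' x -> u b' <= x /\ x < u p & rich w v n t m (a `|` a')]]))).

(** A point of [X] has only |Mu| many tiny subsets of the branch below it, so all
    the parameters range over small sets. *)
Lemma exists_witnessed eps : exists f : L -> L, forall b, witnessed eps b (f b).
Proof.
apply: (@choice_ex _ _ (witnessed eps)) => b; apply: ev_ex; apply: ev_and.
  have [p Xp bp] := unb_gt b uX.
  by apply: ev_imp (ev_gt p) => c' pc; exists p.
apply: ev_pre => Xb.
apply: ev_all => [|w _]; first exact: L_seg.
apply: ev_all => [|v _]; first exact: L_seg.
apply: ev_all => [|n _]; first exact: smallMu.
apply: ev_all => [|t _]; first exact: smallMu.
apply: ev_all => [|m _]; first exact: small_countable.
apply: ev_all => [|a _]; first exact: small_tiny_subsets (small_branch Xb).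
apply: ev_and; last apply: ev_and.
- apply: ev_pre => -[q fq Eq].
  by apply: ev_imp (ev_gt q) => c' qc; exists q.
- apply: ev_pre => r0; have [p Xp pP] := r0 b Xb.
  by apply: ev_imp (ev_gt p) => c' pc; exists p.
- apply: ev_pre => /existsNP[b' /not_implyP[Xb' nb']].
  by apply: ev_imp (ev_gt b') => c' bc; exists b'.
Qed.

(** [d j] are closed ordinals of cofinality mu, and the markers [mk j] in [X]
    between them ensure that the balls considered have a block in each gap. *)
Section Game.
Variables (eps : L) (f : L -> L) (d mk : nat -> L) (w v : L) (n t : Mu) (k : nat).
Hypothesis fP : forall b, witnessed eps b (f b).
Hypothesis d_cof : forall j, cofmu (d j).
Hypothesis d_f : forall j, closed_under f (d j).
Hypothesis d_lt : forall j, d j < d j.+1.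
Hypothesis mkP : forall j, [/\ X (mk j), d j <= mk j & mk j < d j.+1].
Hypothesis eps_d : eps < d 0%N.
Hypothesis w_eps : w < eps.
Hypothesis v_s : v < s.

Lemma eps_lt j : eps < d j.
Proof. by elim: j => [|j IH]; [exact: eps_d|exact: lt_trans (d_lt j)]. Qed.

Definition cut b : set K := [set x | exists2 p, X p & p < b /\ x < u p].

(** [d j] has cofinality mu. *)
Lemma cut_bound (a : set K) j b : tiny a -> b < d j ->
  exists p, [/\ X p, b < p, p < d j & forall x, a x -> cut (d j) x -> x < u p].
Proof.
move=> ta bd.
have [|h hP] := @choice_in _ _ b (a `&` cut (d j)) (fun x p => X p /\ (p < d j /\ x < u p)).
  by move=> x [_ [p Xp px]]; exists p.
have ti : tiny (h @` (a `&` cut (d j))) by apply: tiny_image; apply: tiny_sub ta => x [].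
have [_ [x /hP[_ [xd _]] <-] //|b' b'd b'P] := @d_cof j _ ti.
have [[p Xp [bp pf]] _] := fP (Order.max b b').
move: bp; rewrite gt_max => /andP[bp b'p].
have pd : p < d j.
  by apply: lt_trans pf (d_f _); rewrite gt_max bd.
exists p; split=> // x ax cx; have [Xh [_ xh]] := hP x (conj ax cx).
apply: lt_trans xh _; apply: u_lt; [exact: XI|exact: XI|].
by apply: le_lt_trans b'p; apply: b'P; exists x.
Qed.

Lemma notin_cut j x p : ~ cut (d j) x -> X p -> p < d j -> u p <= x.
Proof. by move=> nx Xp pd; rewrite leNgt; apply/negP => xp; apply: nx; exists p. Qed.

Lemma mk_notin_cut j : ~ cut (d j) (u (mk j)).
Proof.
have [Xm dm _] := mkP j; move=> [p Xp [pd]]; rewrite ltNge ltW //.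
by apply: u_lt; [exact: XI|exact: XI|exact: lt_le_trans dm].
Qed.

Lemma cut_le j j' : (j <= j')%N -> cut (d j) `<=` cut (d j').
Proof.
move=> jj' x [p Xp [pd xp]]; exists p => //; split=> //; apply: lt_le_trans pd _.
elim: j' jj' => [|j' IH]; first by rewrite leqn0 => /eqP ->.
rewrite leq_eqVlt => /predU1P[->//|/IH dj]; exact: le_trans dj (ltW (d_lt _)).
Qed.

(** If the position were not rich, then some bound below [d j] would refute it,
    but the next block of the ball around [u q] lies above every such bound. *)
Lemma rich_step q j m a' : X q -> ball v n (u q) (u (mk j)) ->
  (a' `<=` ball v n (u q)) -> (forall x, a' x -> ~ cut (d j) x) -> a' (u (mk j)) ->
  rich w v n t m ((ball v n (u q) `&` cut (d j)) `|` a') ->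
  rich w v n t m.+1 (ball v n (u q) `&` cut (d j)).
Proof.
move=> Xq mkE a'E a'cut a'mk ra; apply: contrapT => nr.
set a := ball v n (u q) `&` cut (d j) in nr ra.
have ta : tiny a by apply: tiny_sub (@tiny_ball v n (u q)) => x [].
have [p [Xp _ pd pP]] := cut_bound ta (eps_lt j).
have [_ /(_ Xp w w_eps v v_s n Logic.I t Logic.I m Logic.I a)] := fP p.
case; first split=> //.
  move=> x ax; split; first by case: ax => /(ball_branch v_s Xq).
  by apply: pP => //; case: ax.
move=> _ [_ /(_ nr)[b' [Xb' b'f]]]; apply; exists q => //; exists a'; split=> //.
  by exists (u (mk j)).
move=> x a'x; split; last by case: (a'E _ a'x).
by apply: notin_cut (a'cut _ a'x) Xb' _; exact: lt_trans (d_f pd).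
Qed.

(** The blocks of the ball itself are the moves, taken from the last one
    backwards. *)
Lemma rich_tail q : fan w v n t q -> (forall j, (j <= k)%N -> ball v n (u q) (u (mk j))) ->
  rich w v n t k.+1 (ball v n (u q) `&` cut (d 0%N)).
Proof.
move=> fq Emk; have [Xq _ _ _] := fq.
suff H j : (j <= k)%N -> rich w v n t j.+1 (ball v n (u q) `&` cut (d (k - j)%N)).
  by have := H k (leqnn k); rewrite subnn.
elim: j => [|j IH] jk.
  rewrite subn0; apply: (rich_step Xq (a' := ball v n (u q) `&` ~` cut (d k))).
  - exact: Emk.
  - by move=> x [].
  - by move=> x [].
  - by split; [exact: Emk|exact: mk_notin_cut].
  - by rewrite -setIUr setUv setIT; exists q.
have kjE : (k - j = (k - j.+1).+1)%N by rewrite subnSK.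
apply: (rich_step Xq (a' := ball v n (u q) `&` (cut (d (k - j)%N) `\` cut (d (k - j.+1)%N)))).
- by apply: Emk; exact: leq_subr.
- by move=> x [].
- by move=> x [_ []].
- split; [by apply: Emk; exact: leq_subr|split; last exact: mk_notin_cut].
  have [Xm dm md] := mkP (k - j.+1).
  have [[p Xp [mp pf]] _] := fP (mk (k - j.+1)); exists p => //.
  rewrite kjE; split; first exact: lt_trans pf (d_f md).
  by apply: u_lt mp; exact: XI.
- by rewrite -setIUr setDUK; [exact/IH/ltnW|apply: cut_le; rewrite kjE].
Qed.

Section Interleave.
Variable y : L.
Hypothesis ball_y_mk : forall j, (j <= k)%N -> ball v n (u y) (u (mk j)).
Let ball_y := ball v n (u y).

Lemma ball_y_first j p : (j <= k)%N -> X p -> p < d j -> exists2 x0, ball_y x0 &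
  [/\ u p <= x0, x0 <= u (mk j) & forall b, ball_y b -> u p <= b -> x0 <= b].
Proof.
move=> jk Xp pd; have pm : u p <= u (mk j) by apply: notin_cut (@mk_notin_cut j) Xp pd.
have [|x0 [Ex0 px0] x0P] := K_wo (A := [set x | ball_y x /\ u p <= x]).
  by exists (u (mk j)); split=> //; exact: ball_y_mk.
exists x0 => //; split=> // [|b Eb pb]; last exact: x0P.
by apply: x0P; split=> //; exact: ball_y_mk.
Qed.

(** The set [a] built so far ends, on the side of [p], with a point that no
    element of [ball_y] separates from [u p]. To produce no switch, the next block
    is placed in the same gap; to produce one, it is placed above the next
    block of [ball_y]. Either way the first switch at or above [u p] is at the
    first point of [ball_y] there. *)
Lemma interleave m j l p a : rich w v n t m a -> X p -> p < d j ->
  (forall x, a x -> x < u p) ->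
  (exists2 z, a z & forall x, ball_y x -> z <= x -> u p <= x) ->
  (forall x, ball_y x -> cut (d j) x -> x < u p) ->
  (l <= m)%N -> (j + l <= k)%N ->
  exists x, [/\ fan w v n t x, x < d k, ball v n (u x) `&` [set b | b < u p] = a &
    exists sq, [/\ uniq sq, size sq = l.+1 &
      switch (ball v n (u x)) ball_y `&` [set b | u p <= b] = [set` sq]]].
Proof.
elim: m j l p a => [|m IH] j l p a ra Xp pd ap [z az zP] Eyp lm jl.
all: have jk : (j <= k)%N by exact: leq_trans (leq_addr _ _) jl.
all: have dk : d j <= d k by
  (move: jk; elim: (k) => [|k' IHk]; [by rewrite leqn0 => /eqP->|];
   rewrite leq_eqVlt => /predU1P[->//|/IHk dj]; exact: le_trans dj (ltW (d_lt _))).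
all: have [x0 Ex0 [px0 x0m x0P]] := ball_y_first jk Xp pd.
all: have zp : z < u p by exact: ap.
all: have [q Xq aq] := rich_sub ra.
all: have aP : [set a | a `<=` branch `&` [set x | x < u p] /\ tiny a] a by
  (split; [move=> x ax; split; [exact: (ball_branch v_s Xq (aq _ ax))|exact: ap]
          |exact: tiny_sub aq (@tiny_ball v n (u q))]).
all: have x0_sw B : B z -> switch B ball_y x0 by
  (move=> Bz; split=> //; exists z => //; split; [exact: lt_le_trans px0|
   by move=> b Eb zb; apply/negP; rewrite -leNgt; apply: x0P => //; exact: zP]).
all: have sw_x0 (B : set K) b : (forall c', B c' -> c' < b -> c' < u p) -> u p <= b ->
    switch B ball_y b -> b = x0 by
  (move=> Bb pb [Eb [c' Bc [cb cP']]]; apply/le_anti; rewrite x0P // andbT leNgt;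
   apply/negP => x0b; apply: (cP' x0) => //; apply: ltW; exact: lt_le_trans (Bb _ Bc cb) px0).
  have l0 : l = 0%N by apply/eqP; rewrite -leqn0.
  have [_ /(_ Xp w w_eps v v_s n Logic.I t Logic.I 0%N Logic.I a aP)[/(_ ra)[x [fx xf Ex]] _]] := fP p.
  exists x; split=> //.
  - by apply: lt_le_trans dk; exact: lt_trans xf (d_f pd).
  - by rewrite Ex; apply/seteqP; split=> b; [case|move=> ab; split=> //; exact: ap].
  exists [:: x0]; rewrite l0; split=> //; rewrite Ex; apply/seteqP; split=> b /=.
    by move=> [sb pb]; rewrite inE; apply/eqP/(sw_x0 a) => // c' ac _; exact: ap.
  by rewrite inE => /eqP ->; split=> //; exact: x0_sw.
case: l lm jl => [|l] lm jl.
  have [_ /(_ Xp w w_eps v v_s n Logic.I t Logic.I m Logic.I a aP)[_ [/(_ ra) [p2 [Xp2 p2f [a' [[z' az'] a'P ra']]]] _]]] := fP p.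
  have p2d : p2 < d j by exact: lt_trans p2f (d_f pd).
  have pp2 : u p < u p2 by have [] := a'P _ az'; exact: le_lt_trans.
  have Ey2 x : ball_y x -> u p <= x -> u p2 <= x.
    move=> Ex px; apply: notin_cut (_ : ~ cut (d j) x) Xp2 p2d => cx.
    by have := Eyp x Ex cx; rewrite ltNge px.
  have [|||||x [fx xd Ex [sq [usq ssq sqE]]]] := IH j 0%N p2 _ ra' Xp2 p2d.
  - by move=> x [/ap/lt_trans/(_ pp2)//|/a'P[]].
  - by exists z; [left|move=> x Exx /(zP _ Exx); exact: Ey2].
  - by move=> x Exx cx; apply: lt_trans pp2; exact: Eyp.
  - by [].
  - by [].
  exists x; split=> //.
    apply/seteqP; split=> b.
      move=> [Eb bp]; have : (a `|` a') b by rewrite -Ex; split=> //; exact: lt_trans pp2.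
      by case=> // /a'P[]; rewrite leNgt bp.
    by move=> ab; split; [have : (a `|` a') b by left|exact: ap]; rewrite -Ex => -[].
  exists sq; split=> //; rewrite -sqE; apply/seteqP; split=> b [sb pb]; split=> //.
    by apply: Ey2 => //; case: sb.
  exact: le_trans (ltW pp2) pb.
have jk1 : (j.+1 <= k)%N by apply: leq_trans jl; rewrite addnS ltnS leq_addr.
have [Xm dm md] := mkP j.
have [p1 [Xp1 mp1 p1d p1P]] := cut_bound (j := j.+1) (@tiny_ball v n (u y)) md.
have pp1 : p < p1 by apply: lt_trans mp1; exact: lt_le_trans dm.
have upp1 : u p < u p1 by apply: u_lt => //; exact: XI.
have aP1 : [set a | a `<=` branch `&` [set x | x < u p1] /\ tiny a] a.
  case: aP => asub ta; split=> // x ax; have [? xp] := asub x ax.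
  by split=> //; exact: lt_trans upp1.
have [_ /(_ Xp1 w w_eps v v_s n Logic.I t Logic.I m Logic.I a aP1)[_ [/(_ ra) [p2 [Xp2 p2f [a' [[z' az'] a'P ra']]]] _]]] := fP p1.
have p2d : p2 < d j.+1 by exact: lt_trans p2f (d_f p1d).
have pp2 : u p1 < u p2 by have [] := a'P _ az'; exact: le_lt_trans.
have Ey2 x : ball_y x -> u p1 <= x -> u p2 <= x.
  move=> Ex px; apply: notin_cut (_ : ~ cut (d j.+1) x) Xp2 p2d => cx.
  by have := p1P x Ex cx; rewrite ltNge px.
have [|||||x [fx xd Ex [sq [usq ssq sqE]]]] := IH j.+1 l p2 _ ra' Xp2 p2d.
- by move=> x [/ap xp|/a'P[]//]; exact: lt_trans (lt_trans upp1 pp2).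
- exists z'; [by right|move=> x Exx z'x; apply: Ey2 => //].
  by apply: le_trans z'x; have [] := a'P _ az'.
- by move=> x Exx cx; apply: lt_trans pp2; exact: p1P.
- by [].
- by rewrite addSnnS.
exists x; split=> //.
  apply/seteqP; split=> b.
    move=> [Eb bp]; have : (a `|` a') b.
      by rewrite -Ex; split=> //; exact: lt_trans (lt_trans upp1 pp2).
    by case=> // /a'P[]; rewrite leNgt (lt_trans bp upp1).
  by move=> ab; split; [have : (a `|` a') b by left|exact: ap]; rewrite -Ex => -[].
have x0p1 : x0 < u p1.
  by apply: le_lt_trans x0m _; apply: u_lt => //; exact: XI.
exists (x0 :: sq); split=> /=.
- rewrite usq andbT; apply/negP => x0sq.
  have [_ /=] : (switch (ball v n (u x)) ball_y `&` [set b | u p2 <= b]) x0 by rewrite sqE.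
  by rewrite leNgt (lt_trans x0p1 pp2).
- by rewrite ssq.
apply/seteqP; split=> b /=.
  move=> [sb pb]; rewrite inE; case: (leP (u p2) b) => [p2b|bp2].
    by apply/orP; right; have : [set` sq] b by rewrite -sqE.
  apply/orP; left; apply/eqP/(sw_x0 (ball v n (u x))) => // c' Ec cb.
  have [Eb _] := sb.
  have bp1 : b < u p1 by rewrite ltNge; apply/negP => /(Ey2 b Eb); rewrite leNgt bp2.
  have : (a `|` a') c' by rewrite -Ex; split=> //; exact: lt_trans bp2.
  by case=> [/ap//|/a'P[]]; rewrite leNgt (lt_trans cb bp1).
rewrite inE => /orP[/eqP ->|bsq].
  split=> //; apply: x0_sw; have : (a `|` a') z by left.
  by rewrite -Ex => -[].
have [sb p2b] : (switch (ball v n (u x)) ball_y `&` [set b | u p2 <= b]) b by rewrite sqE.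
by split=> //; exact: le_trans (ltW (lt_trans upp1 pp2)) p2b.
Qed.
End Interleave.
End Game.

(** Minimality of [s] gives a bound [eps] such that every later point has points
    below [eps] at distances cofinal in [s]. So for a point [q] beyond the
    markers there is [w] below [eps] such that the ball of radius
    [v = rho (u w) (u q)] around [u q] contains the markers. Unboundedly many
    [q] agree on [w], [v] and the other parameters; two of them, [x1] and [y],
    are linked. The ball around [y] is kept, and [x1], which shows that the game
    can be won, is replaced by a point [x] whose blocks interleave with those
    of [y] as desired. The first move is made once and for all; it fixes the part
    of the oscillation of [x] and [y] below [u p2], to which the [l.+1] switches
    above are added. *)
Lemma chain_realized i : realized i.
Proof.
pose k := (2 ^ i.+1)%N.
have [eps epsP] : exists eps, forall s', [set s' | s' < s] s' -> forall q, I q -> eps <= q ->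
    exists p, [/\ X p, p < eps & s' <= rho (u p) (u q)].
  apply: ev_ex; apply: ev_all => [|s' s's]; first exact: L_seg.
  by apply: escape => //; exact: s_min.
have [f fP] := exists_witnessed eps.
have [nd ndP] := choice_ex (exists_closed f).
pose d j := iter j.+1 nd eps.
have d_lt j : d j < d j.+1 by rewrite {2}/d iterS; have [] := ndP (d j).
have eps_d : eps < d 0%N by have [] := ndP eps.
have d_cof j : cofmu (d j) by have [] := ndP (iter j nd eps).
have d_f j : closed_under f (d j) by have [] := ndP (iter j nd eps).
have d_le : {homo d : j j' / (j <= j')%N >-> j <= j'}.
  by apply: (homo_leq lexx le_trans) => j; exact: ltW.
have [j|mk mkP] := @choice_ex _ _ (fun j p => [/\ X p, d j <= p & p < d j.+1]).
  have [[p Xp [dp pf]] _] := fP (d j); exists p; split=> //; first exact: ltW.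
  by apply: lt_trans pf _; apply: d_f.
pose R q (p : L * L * (Mu * Mu)) := [/\ X p.1.1, p.1.1 < q, rho (u p.1.1) (u q) = p.1.2,
  (forall j, (j <= k)%N -> ball p.1.2 p.2.1 (u q) (u (mk j))) & D p.1.1 q < p.2.1 /\ tau p.2.1 q = p.2.2].
have sD : small [set p : L * L * (Mu * Mu) |
    [set p | [set w | w < eps] p.1 /\ [set v | v < s] p.2] p.1 /\ [set: Mu * Mu] p.2].
  apply: small_prod; first by apply: small_prod; exact: L_seg.
  exact: Mu_square.
have uZ := unb_ev uX (ev_ge (d k.+1)).
have [q [Xq dq]|[[w v] [n0 t0]] [[/= w_eps v_s] _] uZR] := pigeonhole_unb (R := R) sD uZ.
  have mkq j : (j <= k)%N -> mk j < q.
    by have [_ _ md] := mkP j => jk; apply: lt_le_trans md (le_trans (d_le _ _ _) dq).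
  have mkX j : X (mk j) by case: (mkP j).
  have [j0 j0k j0P] := fin_argmax (fun j => rho (u (mk j)) (u q)) k.
  have eq : eps <= q by apply: le_trans dq; apply: le_trans (ltW eps_d) (d_le _ _ _).
  have [w [Xw w_eps mw]] := epsP _ (chX (mkX j0) Xq (mkq _ j0k)) q (XI Xq) eq.
  have wq : w < q by exact: lt_le_trans eq.
  pose v := rho (u w) (u q).
  have [j1 j1k j1P] := fin_argmax (fun j => idx (u q) v (u (mk j))) k.
  pose n0 := nx (Order.max (idx (u q) v (u (mk j1))) (D w q)).
  have := lt_nx (Order.max (idx (u q) v (u (mk j1))) (D w q)).
  rewrite -/n0 gt_max => /andP[in0 Dn0].
  exists (w, v, (n0, tau n0 q)); first by do !split=> //=; exact: chX.
  split=> //= j jk; split; first by apply: u_lt (mkq _ jk); exact: XI.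
    by apply: le_trans mw; exact: j0P.
  by apply: le_lt_trans in0; exact: j1P.
have [|x1 [y [[[Xx1 _] Rx1] [[Xy dy] Ry] xy Rxy]]] := linked_unb _ uZR.
  by move=> q [[/XI]].
have [/= Xw wx1 rx1 Ex1 [Dx1 tx1]] := Rx1; have [/= _ wy ry Ey [Dy ty]] := Ry.
pose n := D x1 y; have n0n : n0 <= n by apply: tauD; [exact: XI|exact: XI| |rewrite tx1 ty].
have E_mono q j : ball v n0 q j -> ball v n q j.
  by move=> [? ? lt0]; split=> //; exact: lt_le_trans n0n.
pose t := tau (nx n) x1.
have fx1 : fan w v n t x1 by [].
have Ex1' j : (j <= k)%N -> ball v n (u x1) (u (mk j)) by move=> /Ex1 /E_mono.
have Ey' j : (j <= k)%N -> ball v n (u y) (u (mk j)) by move=> /Ey /E_mono.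
have rt := rich_tail fP d_cof d_f d_lt mkP eps_d w_eps v_s fx1 Ex1'.
set a0 := ball v n (u x1) `&` cut (d 0%N) in rt.
have ta : tiny a0 by apply: tiny_sub (@tiny_ball v n (u x1)) => x [].
have [p1 [Xp1 ep1 p1d p1P]] := cut_bound fP d_cof d_f (j := 0%N) ta eps_d.
have [p0 [Xp0 p10 p0d p0P]] := cut_bound fP d_cof d_f (j := 0%N) (@tiny_ball v n (u y)) p1d.
have p10' : u p1 < u p0 by apply: u_lt => //; exact: XI.
have aP : [set a | a `<=` branch `&` [set x | x < u p0] /\ tiny a] a0.
  split=> // x [Ex cx]; split; first exact: (ball_branch v_s Xx1 Ex).
  by apply: lt_trans p10'; apply: p1P.
have [_ /(_ Xp0 w w_eps v v_s n Logic.I t Logic.I k Logic.I a0 aP)] := fP p0.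
move=> [_ [/(_ rt)[p2 [Xp2 p2f [a' [[z az] a'P ra]]]] _]].
have p2d : p2 < d 0%N by exact: lt_trans p2f (d_f _ _ p0d).
have p02 : u p0 < u p2 by have [] := a'P _ az; exact: le_lt_trans.
have Ey2 x : ball v n (u y) x -> u p0 <= x -> u p2 <= x.
  move=> Ex px; apply: notin_cut (_ : ~ cut (d 0%N) x) Xp2 p2d => cx.
  by have := p0P x Ex cx; rewrite ltNge px.
pose i0 := #|` fset_set (topfin (switch (a0 `|` a') (ball v n (u y) `&` [set b | b < u p2])))|%fset.
have [l lk lE] := logn2_hit i i0.
have lk' : (l <= k)%N by exact: ltnW.
have [|||||x [[Xx wx rx tx] xd Ex [sq [usq ssq sqE]]]] :=
  interleave fP d_cof d_f d_lt mkP w_eps v_s Ey' (j := 0%N) (l := l) ra Xp2 p2d.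
- by move=> x [[Exx cx]|/a'P[]//]; apply: lt_trans p02; apply: lt_trans p10'; exact: p1P.
- exists z; [by right|move=> x Exx zx; apply: Ey2 => //].
  by apply: le_trans zx; have [] := a'P _ az.
- by move=> x Exx cx; apply: lt_trans p02; exact: p0P.
- exact: lk'.
- exact: lk'.
have dky : d k < y by apply: lt_le_trans (d_lt k) dy.
have xy' : x < y by exact: lt_trans dky.
have [Rxy' Dxy] : linked x y /\ D x y = n.
  by apply: (tau_linked _ _ _ xy Rxy (lt_nx _) tx); exact: XI.
exists x, y, w; split; first by split; exact: XI.
split; first by split=> //; apply/nesym/lt_ne.
rewrite Dxy; split=> //.
- apply: (@tauDlt n x1); [exact: XI|exact: XI|exact: XI|exact/nesym/lt_ne| |].
    by rewrite DC; exact: lt_le_trans n0n.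
  by apply: tau_le tx; exact: ltW (lt_nx _).
- by rewrite DC; exact: lt_le_trans n0n.
rewrite /triple_colour (u_lt (XI Xw) (XI Xx) wx) rx ry eqxx linkedD ?Dxy //; try exact: XI; last exact: lt_ne.
rewrite (osc_split (S := switch (a0 `|` a') (ball v n (u y) `&` [set b | b < u p2])) (sq := sq) (b := u p2)) //.
- by rewrite ssq.
- rewrite -sqE; apply/seteqP; split=> b.
    move=> sb; case: (leP (u p2) b) => [p2b|bp2]; [by right|left].
    have [Eb [c' Ec [cb cP']]] := sb; split=> //; exists c'.
      by rewrite -Ex; split=> //; exact: lt_trans bp2.
    by split=> // b' [Eb' _]; exact: cP'.
  case=> [|[]//] [[Eb bp2] [c' ac [cb cP']]]; split=> //; exists c'.
    by have [] : (ball v n (u x) `&` [set b | b < u p2]) c' by rewrite Ex.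
  split=> // b' Eb' cb' b'b; apply: (cP' b') => //; split=> //.
  exact: lt_trans bp2.
- by move=> b [[]].
- by move=> b bsq; have [] : (switch (ball v n (u x)) (ball v n (u y)) `&` [set b | u p2 <= b]) b by rewrite sqE.
Qed.

End Chain.

Theorem all_realized i : realized i.
Proof.
have [[X0 [s0 [XI0 uX0 ch0]]]|nch] := pselect (exists X s, [/\ X `<=` I, unbounded X & chain X s]).
  have [|s [X [XI uX ch]] smin] := L_wo (A := [set s | exists X, [/\ X `<=` I, unbounded X & chain X s]]).
    by exists s0, X0.
  apply: (chain_realized XI uX ch) => s' Y s's YI uY chY.
  by have := smin s' (ex_intro _ Y (And3 YI uY chY)); rewrite leNgt s's.
have [row|nrow] := pselect (exists2 p, I p & forall b, exists q, [/\ I q, p < q & b <= rho (u p) (u q)]).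
  exact: case_row.
exact: case_unbounded.
Qed.

End Family.

(** * From finite sets to triples of points *)

(** Take at most one point between consecutive ordinals closed under bounds for
    the exceptions. *)
Lemma sparse (Z : set L) (R : L -> L -> Prop) : unbounded Z -> (forall p, Z p -> eventually (R p)) ->
  exists Y, [/\ Y `<=` Z, unbounded Y & forall p q, Y p -> Y q -> p < q -> R p q].
Proof.
move=> uZ ZR; have [l0 _] := L_inh.
have [f fP] := @choice_in _ _ l0 Z (fun p b => forall q, b <= q -> R p q) ZR.
exists [set q | Z q /\ exists d, [/\ closed_under f d, d <= q &
  forall q', Z q' -> d <= q' -> q <= q']]; split=> [q []//|b|p q].
  have [d [bd _ fd]] := exists_closed f b.
  have [q Zq dq] := uZ d.
  have [|q0 [Zq0 dq0] q0P] := L_wo (A := [set q | Z q /\ d <= q]); first by exists q.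
  exists q0; last exact: le_trans (ltW bd) dq0.
  by split=> //; exists d; split=> // q' Zq' dq'; apply: q0P.
move=> [Zp _] [Zq [d [fd dq qP]]] pq; apply: (fP p Zp).
apply: le_trans dq; apply: ltW; apply: fd; rewrite ltNge; apply/negP => /(qP _ Zp).
by rewrite leNgt pq.
Qed.

(** Below the least [g] that has unboundedly many values under it, each initial
    part of the values is taken only boundedly often. *)
Lemma increasing_subfamily (Z : set L) (u : L -> K) : unbounded Z ->
  (forall p q, Z p -> Z q -> u p = u q -> p = q) ->
  exists Y, [/\ Y `<=` Z, unbounded Y & forall p q, Y p -> Y q -> p < q -> u p < u q].
Proof.
move=> uZ u_inj.
have [Z1 [Z1Z uZ1 Z1P]] : exists Z1, [/\ Z1 `<=` Z, unbounded Z1 &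
    forall p, Z1 p -> ~ unbounded [set q | Z1 q /\ u q < u p]].
  have [/K_wo[g ug gmin]|/set0P/negP/negPn/eqP g0] :=
      pselect ([set g | unbounded [set q | Z q /\ u q < g]] !=set0).
    exists [set q | Z q /\ u q < g]; split=> // [q []//|p [Zp pg] nu].
    have /gmin : unbounded [set q | Z q /\ u q < u p] by apply: unb_sub nu => q [[]].
    by rewrite leNgt pg.
  exists Z; split=> // p Zp nu.
  by suff : (set0 : set K) (u p) by []; rewrite -g0.
have [p Z1p|Y [YZ uY YP]] := sparse (R := fun p q => Z1 q -> u p < u q) uZ1.
  have evp : eventually (fun q => ~ (Z1 q /\ u q < u p)) by apply: contrapT => /unbP /(Z1P p Z1p).
  apply: ev_imp (ev_and evp (ev_gt p)) => q [nq pq] Z1q.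
  case: (ltgtP (u p) (u q)) => // [qp|E]; first by case: nq.
  by move: pq; rewrite (u_inj p q) ?ltxx //; exact: Z1Z.
exists Y; split=> // [q /YZ/Z1Z//|p q Yp Yq pq].
by apply: YP => //; exact: YZ.
Qed.

(** Drop colours that can be avoided on an unbounded subset, as long as there are
    any. *)
Lemma prevalent_colour (J : L -> L -> nat) (S : seq nat) (Z : set L) : unbounded Z ->
  (forall x y, Z x -> Z y -> x <> y -> J x y \in S) ->
  exists Y j0, [/\ Y `<=` Z, unbounded Y & forall X, X `<=` Y -> unbounded X ->
    exists x y, [/\ X x, X y, x <> y & J x y = j0]].
Proof.
elim: S Z => [|j S IH] Z uZ ZS.
  have [l0 _] := L_inh; have [x Zx _] := uZ l0; have [y Zy xy] := unb_gt x uZ.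
  have /(ZS x y Zx Zy) // : x <> y by move=> E; move: xy; rewrite E ltxx.
have [[X [XZ uX XP]]|n] := pselect (exists X, [/\ X `<=` Z, unbounded X &
    forall x y, X x -> X y -> x <> y -> J x y <> j]).
  have [|Y [j0 [YX uY YP]]] := IH X uX.
    move=> x y Xx Xy xy; have := ZS x y (XZ _ Xx) (XZ _ Xy) xy.
    by rewrite inE => /orP[/eqP /(XP x y Xx Xy xy)|].
  by exists Y, j0; split=> // q /YX/XZ.
exists Z, j; split=> // X XZ uX; apply: contrapT => nX; apply: n; exists X; split=> //.
by move=> x y Xx Xy xy E; apply: nX; exists x, y.
Qed.

Lemma deltaCC x y : delta x y = delta y x.
Proof. by have [->//|/deltaC] := pselect (x = y). Qed.

Lemma delta_agree n x y : n <= delta x y -> agree n x y.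
Proof. by have [->//|/agree_delta H] := pselect (x = y); rewrite -H. Qed.

Lemma agree_delta_eq n x x' y : agree n x' x -> x <> y -> delta x y < n ->
  delta x' y = delta x y.
Proof.
move=> ag xy dn; have [axy nxy] := deltaP xy.
have x'y : x' <> y by move=> E; apply: nxy; rewrite -(ag _ dn) E.
apply/le_anti/andP; split; last first.
  apply/agree_delta => // i id; rewrite -axy //; apply: ag; exact: lt_trans dn.
rewrite leNgt; apply/negP => lt; have [ax'y _] := deltaP x'y.
by apply: nxy; rewrite -(ax'y _ lt) (ag _ dn).
Qed.

(** Three points of binary branching cannot have the same maximal [delta], so
    the least point of a pair of maximal [delta] determines the pair. *)
Definition selects (A : set K) (x y z : K) : Prop :=
  [/\ [/\ A x, A y & A z], [/\ x < y, z <> x & z <> y],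
    (forall a b, A a -> A b -> a < b -> delta a b < delta x y \/
       (delta a b = delta x y /\ (x < a \/ (a = x /\ b = y)))) &
    (forall a, A a -> a <> x -> a <> y -> a <> z -> delta a x < delta z x)].

Definition set_colour (A : set K) : nat :=
  if pselect (exists p : K * K * K, selects A p.1.1 p.1.2 p.2) is left ex
  then let p := sval (cid ex) in triple_colour p.1.1 p.1.2 p.2 else 0%N.

Lemma set_colour_eq (A : set K) x y z : selects A x y z -> set_colour A = triple_colour x y z.
Proof.
move=> sxyz; rewrite /set_colour; case: pselect => [ex|[]]; last by exists (x, y, z).
case: (cid ex) => -[[x' y'] z'] /= [[Ax' Ay' Az'] [xy' zx' zy'] P' Q'].
have [[Ax Ay Az] [xy zx zy] P Q] := sxyz.
have [ex' ey'] : x' = x /\ y' = y.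
  have [l1|[d1 h1]] := P _ _ Ax' Ay' xy'; have [l2|[d2 h2]] := P' _ _ Ax Ay xy.
  - by have := lt_trans l1 l2; rewrite ltxx.
  - by move: l1; rewrite d2 ltxx.
  - by move: l2; rewrite d1 ltxx.
  by case: h1 h2 => [l1|[-> ->]//] [/(lt_trans l1)|[-> ->]//]; rewrite ltxx.
move: Q' zx' zy'; rewrite {}ex' {}ey' => Q' zx' zy'; congr triple_colour.
apply: contrapT => ne; have := lt_trans (Q _ Az' zx' zy' ne) (Q' _ Az zx zy (nesym ne)).
by rewrite ltxx.
Qed.

Lemma small_seq (T : eqType) (sq : seq T) : small [set` sq].
Proof.
have [g _ gi] := Mu_nat; exists (g \o index^~ sq) => // x y /= xs ys.
by move/(gi _ _ Logic.I Logic.I) => E; rewrite -(nth_index x xs) E nth_index.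
Qed.

(** There are at most Mu^{<Mu} = Mu many restrictions below [n]. *)
Lemma exists_code n : exists cd : K -> Mu, forall x y, cd x = cd y <-> agree n x y.
Proof.
have [j _ ji] := Mu_pow (tiny_segment (n := n)); have [a0 _] : exists a : Mu, True by have [h _ _] := Mu_nat; exists (h 0%N).
exists (fun x => j (fun i => if r x (val i) then a0 else nx a0)) => x y; split=> [|ag].
  move/(ji _ _ Logic.I Logic.I) => E i i_n.
  have na : a0 <> nx a0 by move=> E'; have := lt_nx a0; rewrite -E' ltxx.
  have := congr1 (fun h => h (SigSub (mem_set i_n : i \in [set i | i < n]))) E => /=.
  by case: (r x i); case: (r y i) => // /esym.
by congr j; apply: funext => i; rewrite ag //; exact: (set_valP i).
Qed.

Section Reduction.
Variable A : L -> set K.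
Hypothesis A_fin : forall x, finite_set (A x).
Hypothesis A_fib : forall a, ~ unbounded [set x | A x = a].

(** The root is a largest sequence that is contained in unboundedly many members.
    Then every other point lies in boundedly many of the remaining members, and
    these are thinned out by [sparse]. *)
Lemma delta_system : exists (I : set L) (root : seq K) (m : nat) (pt : nat -> L -> K),
  [/\ unbounded I, (0 < m)%N,
    forall x, I x -> A x = [set` root] `|` [set a | exists2 j, (j < m)%N & a = pt j x],
    forall x j j', I x -> (j < j')%N -> (j' < m)%N -> pt j x < pt j' x &
    (forall x j, I x -> (j < m)%N -> pt j x \notin root) /\
    (forall x y j j', I x -> I y -> (j < m)%N -> (j' < m)%N -> x <> y -> pt j x <> pt j' y)].
Proof.
have [sA sAP] : exists sA : L -> seq K, forall x, A x = [set` sA x].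
  by apply: (@choice_ex _ _ (fun x sq => A x = [set` sq])) => x; apply/finite_seqP.
have uT : unbounded [set: L] by move=> b; exists b.
have [m1 _ uI1] := pigeonhole_unb (D := [set: nat]) (R := fun x m => size (sA x) = m)
  (small_countable _) uT (fun x _ => ex_intro2 _ _ (size (sA x)) Logic.I erefl).
pose P k := `[< exists2 root : seq K, uniq root /\ size root = k &
  unbounded [set x | size (sA x) = m1 /\ {subset root <= sA x}] >].
have P0 : exists k, P k.
  by exists 0%N; apply/asboolP; exists [::] => //; apply: unb_sub uI1 => x [].
have Pm k : P k -> (k <= m1)%N.
  move=> /asboolP[root [ur <-] u_]; have [l0 _] := L_inh.
  by have [x [<- rs] _] := u_ l0; exact: uniq_leq_size.
case: (ex_maxnP P0 Pm) => k /asboolP[root [ur sr] uI2] kmax.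
set I2 := [set x | _ /\ _] in uI2.
have evg g : g \notin root -> eventually (fun x => I2 x -> g \notin sA x).
  move=> gr; have : ~ unbounded (fun x => I2 x /\ g \in sA x).
    move=> ug; have /kmax : P k.+1.
      apply/asboolP; exists (g :: root); first by rewrite /= gr ur sr.
      apply: unb_sub ug => x [[sx rx] gx]; split=> // a; rewrite inE => /predU1P[->//|].
      exact: rx.
    by rewrite ltnn.
  move=> nu; have : eventually (fun x => ~ (I2 x /\ g \in sA x)) by apply: contrapT => /unbP.
  by apply: ev_imp => x n I2x; apply/negP => gx; apply: n.
pose I2' := [set x | I2 x /\ A x <> [set` root]].
have uI2' : unbounded I2'.
  by apply: unb_ev => //; apply: contrapT => /evN_unb nu; apply: (A_fib (a := [set` root]));
    apply: unb_sub nu => x /contrapT.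
have [p _|I3 [I3I uI3 I3P]] := sparse (R := fun p q => I2 q -> forall g, g \in sA p -> g \in sA q -> g \in root) uI2'.
  have : eventually (fun q => forall g, [set` sA p] g -> I2 q -> g \in sA q -> g \in root).
    apply: ev_all => [|g _]; first exact: small_seq.
    have [gr|gr] := boolP (g \in root); first exact: ev_true.
    by apply: ev_imp (evg g gr) => q H /H /negbTE ->.
  by apply: ev_imp => q H I2q g gp; exact: H.
pose pts x := sort <=%O [seq g <- undup (sA x) | g \notin root].
have pts_sorted x : sorted <%O (pts x).
  by rewrite lt_sorted_uniq_le sort_uniq filter_uniq ?undup_uniq //=; exact: sort_le_sorted.
have pts_mem x g : (g \in pts x) = (g \in sA x) && (g \notin root).
  by rewrite mem_sort mem_filter mem_undup andbC.
have [m _ uI] := pigeonhole_unb (D := [set: nat]) (R := fun x m => size (pts x) = m)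
  (small_countable _) uI3 (fun x _ => ex_intro2 _ _ (size (pts x)) Logic.I erefl).
have [l0 _] := L_inh.
have A_pts x : I3 x -> A x = [set` root] `|` [set` pts x].
  move=> /I3I[[_ rx] _]; rewrite sAP; apply/seteqP; split=> g /=.
    by rewrite pts_mem => ->; case: (g \in root); [left|right].
  by case=> [/rx//|]; rewrite pts_mem => /andP[].
have m0 : (0 < m)%N.
  have [x [I3x sx] _] := uI l0; rewrite lt0n; apply/eqP => m0.
  have [_] := I3I _ I3x; apply; rewrite A_pts //.
  by move: sx; rewrite m0 => /size0nil ->; apply/seteqP; split=> g; [case|left].
have [g0 _] : exists g : K, True.
  have [x [I3x sx] _] := uI l0; move: m0; rewrite -sx; rewrite -has_predT.
  by case/hasP=> g; exists g.
exists [set x | I3 x /\ size (pts x) = m], root, m, (fun j x => nth g0 (pts x) j); split=> //.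
- move=> x [I3x sx]; rewrite A_pts //; congr setU; apply/seteqP; split=> g /=.
    by move=> gx; exists (index g (pts x)); rewrite ?nth_index // -sx index_mem.
  by move=> [j jm ->]; rewrite mem_nth ?sx.
- move=> x j j' [_ sx] jj' j'm.
  by rewrite lt_sorted_ltn_nth ?inE ?sx //; exact: ltn_trans j'm.
split.
- move=> x j [_ sx] jm; have : nth g0 (pts x) j \in pts x by rewrite mem_nth ?sx.
  by rewrite pts_mem => /andP[].
move=> x y j j' [I3x sx] [I3y sy] jm j'm xy E.
have : nth g0 (pts x) j \in pts x by rewrite mem_nth ?sx.
have : nth g0 (pts y) j' \in pts y by rewrite mem_nth ?sy.
rewrite -E !pts_mem => /andP[gy nr] /andP[gx _]; move/negP: nr; apply.
have [I2x _] := I3I _ I3x; have [I2y _] := I3I _ I3y.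
by case: (ltgtP x y) => // lt; [apply: I3P lt _ _ _ _|apply: I3P lt _ _ _ _].
Qed.

(** The set [B] ranges over everything that the product of the three members may
    be mapped to. *)
Theorem family_realized i : exists x y z,
  [/\ x <> y, x <> z & y <> z] /\
  [/\ exists2 a, A x a & ~ A y a /\ ~ A z a, exists2 a, A y a & ~ A x a /\ ~ A z a,
      exists2 a, A z a & ~ A x a /\ ~ A y a &
  forall B, (forall a, A x a -> ~ A y a -> ~ A z a -> B a) ->
    (forall a, A y a -> ~ A x a -> ~ A z a -> B a) ->
    (forall a, A z a -> ~ A x a -> ~ A y a -> B a) ->
    B `<=` A x `|` A y `|` A z -> set_colour B = i].
Proof.
have [I1 [root [m [pt [uI1 m0 A1 pt_lt [pt_root pt_ne]]]]]] := delta_system.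
(* The points of each single set are separated below a common level [nc]. *)
have sep x : exists n, forall a b, A x a -> A x b -> a <> b -> delta a b < n.
  have fin : finite_set [set delta p.1 p.2 | p in A x `*` A x].
    by apply: finite_image; exact: finite_setX.
  have [n nP] := Mu_reg (tiny_finite fin); exists n => a b Aa Ab _.
  by apply: nP; exists (a, b).
have [nc _ uI2] := pigeonhole_unb (D := [set: Mu])
  (R := fun x n => forall a b, A x a -> A x b -> a <> b -> delta a b < n)
  (smallMu _) uI1 (fun x _ => let: ex_intro n nP := sep x in ex_intro2 _ _ n Logic.I nP).
have [cd cdP] := choice_ex exists_code.
have [jm _ jmi] := Mu_pow (tiny_finite (finite_finset (X := [set: 'I_m]))).
pose tau n x := jm (fun j : 'I_m => cd n (pt j x)).
have tauP n x y : tau n x = tau n y <-> forall j, (j < m)%N -> agree n (pt j x) (pt j y).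
  split=> [/(jmi _ _ Logic.I Logic.I) E j jm'|H].
    by apply/cdP; exact: (congr1 (@^~ (Ordinal jm')) E).
  by congr jm; apply: funext => j; apply/cdP/H.
have [t0 _ uI3] := pigeonhole_unb (D := [set: Mu]) (R := fun x t => tau nc x = t)
  (smallMu _) uI2 (fun x _ => ex_intro2 _ _ (tau nc x) Logic.I erefl).
set I3 := (fun _ => _ /\ _) in uI3.
have I31 x : I3 x -> I1 x by case=> -[].
have I3_sep x a b : I3 x -> A x a -> A x b -> a <> b -> delta a b < nc.
  by case=> -[_ H] _; exact: H.
have A_pt x j : I3 x -> (j < m)%N -> A x (pt j x).
  by move=> /I31/A1 -> jm'; right; exists j.
have A_root x a : I3 x -> a \in root -> A x a by move=> /I31/A1 -> ar; left.
have I3_agree x y j : I3 x -> I3 y -> (j < m)%N -> agree nc (pt j x) (pt j y).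
  by move=> [_ tx] [_ ty] jm'; have /tauP H : tau nc x = tau nc y; [rewrite tx ty|exact: H].
have pt_inj x j j' : I3 x -> (j < m)%N -> (j' < m)%N -> j <> j' -> pt j x <> pt j' x.
  move=> /I31 I1x jm' j'm; case: (ltngtP j j') => // lt _ E.
    by have := pt_lt _ _ _ I1x lt j'm; rewrite E ltxx.
  by have := pt_lt _ _ _ I1x lt jm'; rewrite E ltxx.
have cross x y j j' : I3 x -> I3 y -> (j < m)%N -> (j' < m)%N -> j <> j' ->
    delta (pt j x) (pt j' y) < nc.
  move=> Ix Iy jm' j'm jj'; rewrite ltNge; apply/negP => /delta_agree ag.
  have ne := pt_inj x j j' Ix jm' j'm jj'.
  have := I3_sep x _ _ Ix (A_pt x j Ix jm') (A_pt x j' Ix j'm) ne.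
  rewrite ltNge => /negP; apply; apply/agree_delta => //.
  exact: agree_trans ag (I3_agree _ _ _ Iy Ix j'm).
(* [J] is the least coordinate at which two members agree longest; taking the
   least one makes it the coordinate of the pair that [selects] singles out. *)
have [J JP] : exists J : L * L -> nat, forall p, [/\ (J p < m)%N,
    forall j, (j < m)%N -> delta (pt j p.1) (pt j p.2) <= delta (pt (J p) p.1) (pt (J p) p.2) &
    forall j, (j < J p)%N -> delta (pt j p.1) (pt j p.2) < delta (pt (J p) p.1) (pt (J p) p.2)].
  apply: (@choice_ex _ _ (fun p J => [/\ (J < m)%N,
    forall j, (j < m)%N -> delta (pt j p.1) (pt j p.2) <= delta (pt J p.1) (pt J p.2) &
    forall j, (j < J)%N -> delta (pt j p.1) (pt j p.2) < delta (pt J p.1) (pt J p.2)])) => p.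
  have [j0 j0m j0P] := fin_argmax (fun j => delta (pt j p.1) (pt j p.2)) m.-1.
  have mE : m = m.-1.+1 by rewrite prednK.
  have ex : exists j, (j < m)%N && (delta (pt j p.1) (pt j p.2) == delta (pt j0 p.1) (pt j0 p.2)).
    by exists j0; rewrite eqxx andbT mE ltnS.
  case: (ex_minnP ex) => j /andP[jm' /eqP jE] jmin; exists j; split=> // j'.
    by rewrite jE {1}mE ltnS; exact: j0P.
  move=> j'j; have j'm := ltn_trans j'j jm'; rewrite jE lt_neqAle j0P -1?ltnS -?mE // andbT.
  by apply/negP => /eqP E; move: j'j; rewrite ltnNge jmin // j'm E eqxx.
have J_eq p j : (j < m)%N ->
    (forall j', (j' < m)%N -> delta (pt j' p.1) (pt j' p.2) <= delta (pt j p.1) (pt j p.2)) ->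
    (forall j', (j' < j)%N -> delta (pt j' p.1) (pt j' p.2) < delta (pt j p.1) (pt j p.2)) ->
    J p = j.
  move=> jm' le_ lt_; have [Jm Jle Jlt] := JP p.
  case: (ltngtP (J p) j) => // [/lt_|/Jlt]; rewrite ltNge; [rewrite Jle|rewrite le_] => //.
pose D x y := delta (pt (J (x, y)) x) (pt (J (x, y)) y).
have leD x y j : (j < m)%N -> delta (pt j x) (pt j y) <= D x y.
  by have [_ H _] := JP (x, y); exact: H.
have JC x y : J (x, y) = J (y, x).
  by have [Jm Jle Jlt] := JP (y, x); apply: J_eq => // j jm' /=;
    rewrite (deltaCC (pt j x)) (deltaCC (pt (J (y, x)) x)); [exact: Jle|exact: Jlt].
have DC x y : D x y = D y x by rewrite /D JC deltaCC.
have [|I4 [j0 [I43 uI4 j0P]]] := prevalent_colour (J := fun x y => J (x, y)) (S := iota 0 m) uI3.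
  by move=> x y _ _ _; have [Jm _ _] := JP (x, y); rewrite mem_iota.
have j0m : (j0 < m)%N.
  have [x [y [_ _ _ <-]]] := j0P I4 (@subset_refl _ I4) uI4.
  by have [] := JP (x, y).
have [p q Ip Iq|I5 [I54 uI5 u_lt]] := increasing_subfamily (u := pt j0) uI4.
  by move=> E; apply: contrapT => pq; apply: pt_ne E => //; exact/I31/I43.
have I53 x : I5 x -> I3 x by move=> /I54/I43.
have ne_pt x y j : I5 x -> I5 y -> (j < m)%N -> x <> y -> pt j x <> pt j y.
  by move=> /I53/I31 Ix /I53/I31 Iy jm' xy; exact: pt_ne.
have tau_delta n x x' y j : I5 x -> I5 y -> x <> y -> (j < m)%N -> tau n x' = tau n x ->
    delta (pt j x) (pt j y) < n -> delta (pt j x') (pt j y) = delta (pt j x) (pt j y).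
  move=> Ix Iy xy jm' /tauP/(_ j jm') ag; apply: agree_delta_eq => //; exact: ne_pt.
have [||||||||x [y [z [[Ix Iy Iz] [[xy xz yz] [Jxy Dxz Dyz colE]]]]]] :=
    all_realized uI5 (u := pt j0) (linked := fun x y => J (x, y) = j0) (D := D) (tau := tau) _ _ _ _ _ _ _ _ i.
- by [].
- move=> X XI uX; apply: j0P => //; exact: subset_trans XI I54.
- exact: DC.
- by move=> x y _ _ _ /= Jxy; rewrite /D Jxy.
- move=> n x y Ix Iy xy /tauP ag; apply: le_trans (leD x y 0%N m0).
  by apply/agree_delta; [exact: ne_pt|exact: ag].
- move=> n x x' z Ix Ix' Iz xz Dn tx; have [Jm _ _] := JP (x', z).
  rewrite /D (tau_delta n x) //; first exact: le_lt_trans (leD _ _ _ Jm) Dn.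
  exact: le_lt_trans (leD _ _ _ Jm) Dn.
- move=> n x x' y Ix Ix' Iy xy /= Jxy Dn tx.
  have dE j : (j < m)%N -> delta (pt j x') (pt j y) = delta (pt j x) (pt j y).
    by move=> jm'; apply: (tau_delta n) => //; exact: le_lt_trans (leD _ _ _ jm') Dn.
  have Jx'y : J (x', y) = j0.
    have [Jm Jle Jlt] := JP (x, y); rewrite Jxy in Jm Jle Jlt.
    apply: J_eq => //= j jm'; rewrite !dE //; [exact: Jle|exact: Jlt|exact: ltn_trans Jm].
  by split=> //; rewrite /D Jx'y Jxy dE.
- move=> n n' x y nn' /tauP ag; apply/tauP => j jm'; apply: agree_le nn' _; exact: ag.
have [xy' yx'] := (lt_ne xy, nesym (lt_ne xy)).
have Ix3 := I53 _ Ix; have Iy3 := I53 _ Iy; have Iz3 := I53 _ Iz.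
have pt_notin v w j : I3 v -> I3 w -> (j < m)%N -> v <> w -> ~ A w (pt j v).
  move=> Iv Iw jm' vw; rewrite A1; last exact: I31.
  case=> /= [vr|[j' j'm E]]; last by apply: pt_ne E => //; exact: I31.
  by move/negP: (pt_root _ _ (I31 _ Iv) jm').
exists x, y, z; split=> //; split.
- by exists (pt j0 x); [exact: A_pt|split; exact: pt_notin].
- by exists (pt j0 y); [exact: A_pt|split; exact: pt_notin].
- by exists (pt j0 z); [exact: A_pt|split; apply: pt_notin => //; exact: nesym].
move=> B Bx By Bz BA; rewrite -colE; apply: set_colour_eq.
have nD v w : I3 v -> I3 w -> v <> w -> nc <= delta (pt j0 v) (pt j0 w).
  by move=> Iv Iw vw; apply/agree_delta; [apply: pt_ne => //; exact: I31|exact: I3_agree].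
have dxy : delta (pt j0 x) (pt j0 y) = D x y by rewrite /D Jxy.
have nDxy : nc <= D x y by rewrite -dxy; exact: nD.
have B_pt b : B b -> b \in root \/ exists w j, [/\ [\/ w = x, w = y | w = z], (j < m)%N & b = pt j w].
  move=> /BA[[]|]; rewrite A1; try exact: I31.
  - by case=> [|[j jm' ->]]; [left|right; exists x, j; split=> //; constructor 1].
  - by case=> [|[j jm' ->]]; [left|right; exists y, j; split=> //; constructor 2].
  - by case=> [|[j jm' ->]]; [left|right; exists z, j; split=> //; constructor 3].
have I3w w : [\/ w = x, w = y | w = z] -> I3 w by case=> ->.
split.
- by split; [apply: Bx|apply: By|apply: Bz]; try exact: A_pt; apply: pt_notin => //; exact: nesym.
- split; first exact: u_lt.
    by apply: pt_ne => //; [exact: I31|exact: I31|exact: nesym].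
  by apply: pt_ne => //; [exact: I31|exact: I31|exact: nesym].
- move=> a b Ba Bb ab; rewrite dxy.
  have [ar|[w [j [wP jm' aE]]]] := B_pt a Ba.
    left; apply: lt_le_trans nDxy.
    have [br|[w' [j' [w'P j'm bE]]]] := B_pt b Bb.
      by apply: (I3_sep x) => //; [exact: A_root|exact: A_root|exact: lt_ne].
    by rewrite bE; apply: (I3_sep w'); [exact: I3w|apply: A_root => //; exact: I3w|
      apply: A_pt => //; exact: I3w|rewrite -bE; exact: lt_ne].
  have [br|[w' [j' [w'P j'm bE]]]] := B_pt b Bb.
    left; apply: lt_le_trans nDxy.
    by rewrite aE; apply: (I3_sep w); [exact: I3w|apply: A_pt => //; exact: I3w|
      apply: A_root => //; exact: I3w|rewrite -aE; exact: lt_ne].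
  have [jj'|jj'] := pselect (j = j'); last first.
    by left; apply: lt_le_trans nDxy; rewrite aE bE; apply: cross => //; exact: I3w.
  rewrite -{}jj' in bE; rewrite aE bE.
  have far v v' : D v v' < D x y -> delta (pt j v) (pt j v') < D x y.
    by apply: le_lt_trans; exact: leD.
  have near v v' : (v = x /\ v' = y) \/ (v = y /\ v' = x) -> pt j v < pt j v' ->
      delta (pt j v) (pt j v') < D x y \/ delta (pt j v) (pt j v') = D x y /\
      (pt j0 x < pt j v \/ pt j v = pt j0 x /\ pt j v' = pt j0 y).
    move=> vP vv'; have := leD v v' j jm'.
    have -> : D v v' = D x y by case: vP => -[-> ->] //; rewrite DC.
    rewrite le_eqVlt => /predU1P[E|]; [right; split=> //|by left].
    have [_ _ Jlt] := JP (x, y); rewrite Jxy /= dxy in Jlt.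
    have j0j : (j0 <= j)%N.
      rewrite leqNgt; apply/negP => /Jlt.
      by case: vP E => -[-> ->]; rewrite ?(deltaCC (pt j y)) => ->; rewrite ltxx.
    have I1x := I31 _ Ix3; have I1y := I31 _ Iy3; have uxy := u_lt _ _ Ix Iy xy.
    move: j0j; rewrite leq_eqVlt => /predU1P[j0E|j0j].
      case: vP vv' => -[-> ->]; rewrite -j0E; first by right.
      by move/(lt_trans uxy); rewrite ltxx.
    left; case: vP => -[-> _]; first exact: pt_lt.
    by apply: lt_trans uxy _; exact: pt_lt.
  have [ww'|ww'] := pselect (w = w').
    left; apply: lt_le_trans nDxy; rewrite ww' -bE; move: ab; rewrite aE bE ww'.
    by rewrite ltxx.
  rewrite aE bE in ab.
  case: wP w'P ww' ab => -> [] -> // ww' ab; try (by left; apply: far; rewrite // DC);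
    first [by apply: near => //; left|by apply: near => //; right].
- move=> a Ba ax ay az; apply: lt_le_trans (nD z x Iz3 Ix3 (nesym xz)).
  have [ar|[w [j [wP jm' aE]]]] := B_pt a Ba.
    by apply: (I3_sep x) => //; [exact: A_root|exact: A_pt].
  have jj0 : j <> j0 by move=> jE; case: wP aE => ->; rewrite jE.
  by rewrite aE; apply: cross => //; exact: I3w.
Qed.

End Reduction.
End Colour.

Theorem set_colouring (r : K -> Mu -> bool) : injective r -> exists sc : set K -> nat,
  forall A : L -> set K, (forall x, finite_set (A x)) ->
  (forall a, small [set x | A x = a]) -> forall i, exists x y z,
  [/\ x <> y, x <> z & y <> z] /\
  [/\ exists2 a, A x a & ~ A y a /\ ~ A z a, exists2 a, A y a & ~ A x a /\ ~ A z a,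
      exists2 a, A z a & ~ A x a /\ ~ A y a &
  forall B, (forall a, A x a -> ~ A y a -> ~ A z a -> B a) ->
    (forall a, A y a -> ~ A x a -> ~ A z a -> B a) ->
    (forall a, A z a -> ~ A x a -> ~ A y a -> B a) ->
    B `<=` A x `|` A y `|` A z -> sc B = i].
Proof.
move=> r_inj.
have [c cP] := stationary_colouring.
have [e eP] := choice_ex (fun h => let: ex_intro2 f _ fi := small_le h in
  ex_intro (fun f : L -> Mu => forall s t, s <= h -> t <= h -> f s = f t -> s = t) f fi).
have [rho [rho_small rho_le1 rho_le2]] := subadditive_function.
have [idx idxP] := choice_ex (fun p => let: ex_intro2 f _ fi := rho_small p.1 p.2 in
  ex_intro (fun f : K -> Mu => forall x y, x < p.1 /\ rho x p.1 <= p.2 ->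
    y < p.1 /\ rho y p.1 <= p.2 -> f x = f y -> x = y) f fi).
have idx_inj g v x y : x < g -> rho x g <= v -> y < g -> rho y g <= v ->
    idx (g, v) x = idx (g, v) y -> x = y.
  by move=> xg xv yg yv; apply: (idxP (g, v)).
exists (set_colour c e rho (fun g v => idx (g, v)) r_inj) => A A_fin A_fib i.
have {}A_fib a : ~ unbounded [set x | A x = a] by move/unb_large; apply.
exact: (family_realized cP eP rho_small rho_le1 rho_le2 idx_inj r_inj A_fin A_fib i).
Qed.

End Rho.
End Core.

(** * The theorem *)

Lemma card_le_nonempty T U (A : set T) (B : set U) : A #<= B -> A !=set0 -> B !=set0.
Proof.
move=> AB [x Ax]; apply/set0P/negP => /eqP B0.
by move: AB Ax; rewrite B0 => /card_le0P ->.
Qed.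

(** A segment that does not embed into [M] would be larger than [M], hence at
    least as large as [N]. *)
Lemma succ_card_segment dM dN (M : orderType dM) (N : orderType dN) (m0 : M) (x : N) :
  is_succ_card M N -> (forall x : N, ~ embeds [set: N] [set y | y < x]) ->
  embeds [set y | y < x] [set: M].
Proof.
move=> [_ minN] N_init.
have [[z zx]|none] := pselect (exists z, z < x); last first.
  by exists (fun=> m0) => // y z yx; case: none; exists y.
pose S : Type := [set y : N | y < x].
have s0 : S by exists z; exact: (mem_set (zx : [set y : N | y < x] z)).
have S_seg : embeds [set y | y < x] [set: S].
  exists (fun y => if pselect (y < x) is left yx then exist _ y (mem_set (yx : [set y : N | y < x] y)) : S else s0) => //.
  by move=> y y' yx yx'; case: pselect => // ?; case: pselect => // ? [].
have seg_S : embeds [set: S] [set y | y < x].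
  exists (fun y : S => sval y) => [y _|y y' _ _ /val_inj//]; exact: (set_valP y).
apply: embeds_trans S_seg _; apply: contrapT => nSM.
have MS : [set: M] #< [set: S].
  apply/andP; split; last by apply/negP => /(card_le_embeds m0).
  by have [//|/(card_le_embeds s0)] := embeds_total m0 s0.
by have /(card_le_embeds s0)/embeds_trans/(_ seg_S) := minN _ MS; exact: N_init.
Qed.

Local Open Scope group_scope.

Theorem mainTheorem2 (mu mupow mu1 mu2 : Type)
  (mu_infinite : infinite_set [set: mu])
  (mupowE : is_weak_pow mu mupow)
  (mu1E : is_succ_card mu mu1)
  (mu2E : is_succ_card mu1 mu2)
  (mupow_lt : [set: mupow] #< [set: mu1])
  (mu1_lt : [set: mu1] #< [set: mu -> bool])
  (G : magmaType) (G_wb : well_behaved G) (G_size : [set: G] #= [set: mu2]) :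
  exists c : G -> nat,
    forall X : set G, X #= [set: mu1] ->
    forall i : nat,
      exists x y z : G,
        [/\ X x, X y & X z] /\
        [/\ x <> y, x <> z & y <> z] /\
        (c ((x * y) * z) = i /\ c (x * (y * z)) = i).
Proof.
have [Mu [Mu_wo MuE Mu_init]] := initial_order mu.
have [L [L_wo LE L_init]] := initial_order mu1.
have [K [K_wo KE K_init]] := initial_order mu2.
subst mu mu1 mu2.
have [m0 _] := infinite_setN0 mu_infinite.
have [/andP[ML nLM] L_min] := mu1E; have [/andP[LK nKL] K_min] := mu2E.
have MuT : [set: Mu] !=set0 by exists m0.
have [l0 _] := card_le_nonempty ML MuT.
have [k0 _] := card_le_nonempty LK (ex_intro _ l0 I).
have Mu_nat : embeds [set: nat] [set: Mu].
  by apply/(card_le_embeds m0); apply/infiniteP.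
have pow_le : [set: mupow] #<= [set: Mu].
  apply: contrapT => nle; move/andP: mupow_lt => [_ /negP]; apply; apply: L_min.
  apply/andP; split; last exact/negP.
  have [p0|np] := pselect (exists p : mupow, True); last first.
    by case: nle; apply/(card_le_embeds m0); exists (fun=> m0) => // p; case: np; exists p.
  have [p _] := p0; have [/(card_le_embeds p)//|/(card_le_embeds m0)//] := embeds_total p m0.
have Mu_pow T : tiny Mu [set: T] -> embeds [set: T -> Mu] [set: Mu].
  move=> tT; have [[t _]|nT] := pselect (exists t : T, True); last first.
    by exists (fun=> m0) => // f g _ _ _; apply: funext => t; case: nT; exists t.
  apply/(card_le_embeds m0); apply: card_le_trans pow_le; case: mupowE => + _; apply.
  apply/andP; split; last by apply/negP => /(card_le_embeds t).
  by have [/tT//|/(card_le_embeds m0)] := embeds_total t m0.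
have L_seg (x : L) : small Mu [set y | y < x]%O by exact: succ_card_segment mu1E L_init.
have L_large : ~ small Mu [set: L] by move/(card_le_embeds m0) => H; rewrite H in nLM.
have K_seg (g : K) : embeds [set a | a < g]%O [set: L] by exact: succ_card_segment mu2E K_init.
have /(card_le_embeds (fun=> true))[r _ ri] := K_min _ mu1_lt.
have r_inj : injective r by move=> x y; exact: ri.
have [sc scP] := set_colouring Mu_wo Mu_nat Mu_init Mu_pow L_wo L_seg L_large K_wo K_seg r_inj.
have /(card_le_embeds k0)[k _ ki] : [set: G] #<= [set: K] by move: G_size; rewrite card_eq_le => /andP[].
have [phi [phi_fin phi_fib phiP]] := G_wb.
exists (fun g => sc (k @` phi g)) => X X_size i.
have LX : [set: L] #<= X by move: X_size; rewrite card_eq_le => /andP[].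
have [g0 _] := card_le_nonempty LX (ex_intro _ l0 I).
have /(card_le_embeds g0)[h hX hi] := LX.
have kE a b g : k a = k b -> phi g a -> phi g b by move/(ki _ _ I I) => ->.
have mem_k g a : (k @` phi g) (k a) <-> phi g a.
  by split=> [[b pb /kE]|pa]; [apply|exists a].
have [|a|x [y [z [[xy xz yz] [[a1 [a pa <-] [na1 na2]] [b1 [b pb <-] [nb1 nb2]] [c1 [c pc <-] [nc1 nc2]] scB]]]]] :=
    scP (fun x => k @` phi (h x)) _ _ i.
- by move=> x; exact: finite_image.
- have [[x0 x0a]|none] := pselect (exists x, k @` phi (h x) = a); last first.
    by exists (fun=> m0) => // x y xa; case: none; exists x.
  have /countable_injP[f fi] := phi_fib (phi (h x0)).
  have [j _ ji] := Mu_nat.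
  have phi_eq x : k @` phi (h x) = a -> phi (h x) = phi (h x0).
    by rewrite -x0a => E; apply/seteqP; split=> b; rewrite -!mem_k E.
  exists (fun x => j (f (h x))) => // x y /phi_eq hx /phi_eq hy /(ji _ _ I I) /fi.
  by rewrite !inE => /(_ hx hy) /(hi _ _ I I).
exists (h x), (h y), (h z); split; first by split; exact: hX.
have h_ne p q : p <> q -> h p <> h q by move=> pq /(hi _ _ I I).
split; first by split; exact: h_ne.
rewrite -> mem_k in na1, na2, nb1, nb2, nc1, nc2.
have [xyl xyu] := phiP _ _ (h_ne _ _ xy); have [yzl yzu] := phiP _ _ (h_ne _ _ yz).
have xy_z : h x * h y <> h z.
  by move=> E; apply: na2; rewrite -E; apply: xyl; left.
have x_yz : h x <> h y * h z.
  by move=> E; apply: nb1; rewrite E; apply: yzl; left.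
have [l1 u1] := phiP _ _ xy_z; have [l2 u2] := phiP _ _ x_yz.
split; apply: scB.
- move=> _ [d pd <-]; rewrite !mem_k => ny nz; apply: l1; left; split=> //.
  by apply: xyl; left.
- move=> _ [d pd <-]; rewrite !mem_k => nx nz; apply: l1; left; split=> //.
  by apply: xyl; right.
- move=> _ [d pd <-]; rewrite !mem_k => nx ny; apply: l1; right; split=> //.
  by move=> /xyu[].
- move=> _ [d /u1[/xyu[]|] pd <-]; [left; left|left; right|right]; by exists d.
- move=> _ [d pd <-]; rewrite !mem_k => ny nz; apply: l2; left; split=> //.
  by move=> /yzu[].
- move=> _ [d pd <-]; rewrite !mem_k => nx nz; apply: l2; right; split=> //.
  by apply: yzl; left.
- move=> _ [d pd <-]; rewrite !mem_k => nx ny; apply: l2; right; split=> //.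
  by apply: yzl; right.
- move=> _ [d /u2[|/yzu[]] pd <-]; [left; left|left; right|right]; by exists d.
Qed.
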